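(* Let $L,C_\parallel,C_\perp>0$, $\gamma_1,\gamma_2>0$, $\theta^\circ\in[0,2\pi)$, $\phi\in\mathbb{R}$, $x_1^\circ,x_2^\circ\in\mathbb{R}^2$, and let $\lambda\in(0,1)$ be such that the matrix $\mathcal R(\theta_1,\theta_2,\sigma_1,\sigma_2;\lambda)$ defined in the context is invertible for all $(\theta_1,\theta_2,\sigma_1,\sigma_2)\in\mathbb{R}^4$. For $\varepsilon>0$ small and $\tau>0$ small, let $z=(\mathbf x_1,\theta_1,\mathbf x_2,\theta_2,\sigma_1,\sigma_2):[0,4\tau]\to\mathbb{R}^8$ be the solution of the control system $$\dot z=v_1(\theta_1,\theta_2,\sigma_1,\sigma_2;\lambda)\,u_1(t)+v_2(\theta_1,\theta_2,\sigma_1,\sigma_2;\lambda)\,u_2(t)$$ with initial datum $z(0)=z^\circ:=(x_1^\circ,\theta^\circ,x_2^\circ,\theta^\circ,\pi+\varepsilon,\pi+\varepsilon\cos\phi)$ and controls $(u_1,u_2)=(0,-\gamma_2)$ on $[0,\tau)$, $(-\gamma_1,0)$ on $[\tau,2\tau)$, $(0,\gamma_2)$ on $[2\tau,3\tau)$, $(\gamma_1,0)$ on $[3\tau,4\tau)$. Let $v_3^\circ(\phi;\theta^\circ)$ denote the Lie bracket $[v_1(\cdot;\lambda),v_2(\cdot;\lambda)]$ evaluated at $(\theta_1,\theta_2,\sigma_1,\sigma_2)=(\theta^\circ,\theta^\circ,\pi+\varepsilon,\pi+\varepsilon\cos\phi)$. Then, as $\tau\to0^+$ (for fixed $\varepsilon$),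 $$z(4\tau)=z^\circ-\gamma_1\gamma_2\tau^2\,v_3^\circ(\phi;\theta^\circ)+o(\tau^2),$$ and, as $\varepsilon\to0^+$, $$v_3^\circ(\phi;\theta^\circ)=\big(\xi_1\varepsilon^2+o(\varepsilon^2),\ \eta_1\varepsilon^2+o(\varepsilon^2),\ \vartheta_1\varepsilon+o(\varepsilon^2),\ \xi_2\varepsilon^2+o(\varepsilon^2),\ \eta_2\varepsilon^2+o(\varepsilon^2),\ \vartheta_2\varepsilon+o(\varepsilon^2),\ 0,\ 0\big)^\top,$$ where $$\begin{pmatrix}\xi_1\\ \eta_1\end{pmatrix}=\frac{L\lambda\sin^2\frac{\phi}{2}}{64\,C_\parallel C_\perp(1-\lambda^2)}\Big(\big(C_\perp^2(2+\lambda)-C_\parallel C_\perp\big)+\cos\phi\,\big(3C_\parallel^2-2C_\perp C_\parallel-C_\perp^2\big)\Big)\begin{pmatrix}\cos\theta^\circ\\ \sin\theta^\circ\end{pmatrix},$$ $$\begin{pmatrix}\xi_2\\ \eta_2\end{pmatrix}=\frac{L\lambda\sin^2\frac{\phi}{2}}{64\,C_\parallel C_\perp(1-\lambda^2)}\Big(\big(3C_\parallel^2-2C_\parallel C_\perp-C_\perp^2\big)+\cos\phi\,\big(C_\perp^2(2+\lambda)-C_\perp C_\parallel\big)\Big)\begin{pmatrix}\cos\theta^\circ\\ \sin\theta^\circ\end{pmatrix},$$ $$\vartheta_1=\vartheta_2=-\frac{\lambda}{16(1-\lambda)}\sin^2\frac{\phi}{2}.$$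
   Context: The state is $z=(\mathbf x_1,\theta_1,\mathbf x_2,\theta_2,\sigma_1,\sigma_2)\in\mathbb{R}^8$, where $\mathbf x_i\in\mathbb{R}^2$ is the hinge position, $\theta_i$ the orientation and $\sigma_i$ the opening angle of the $i$-th of two hydrodynamically interacting scallops (two links of length $L$ each; drag coefficients $C_\parallel,C_\perp$; interaction parameter $\lambda$, treated as a constant). For vector fields $X,Y$ on $\mathbb{R}^8$ the Lie bracket is $[X,Y]=DY\,X-DX\,Y$. For $v=(a,b)^\top\in\mathbb{R}^2$ write $v^\perp=(-b,a)^\top$; put $\neg i=3-i$. For $i,j\in\{1,2\}$ let $$e_i^{(j)}=\big(\cos(\theta_i+(j-1)\sigma_i),\ \sin(\theta_i+(j-1)\sigma_i)\big)^\top,\qquad E_i^{(j)}=e_i^{(j)}(e_i^{(j)})^\top,$$ $$A_i=L\big[2C_\perp I+(C_\parallel-C_\perp)(E_i^{(1)}+E_i^{(2)})\big],\quad b_i=\tfrac{L^2}{2}C_\perp\big(e_i^{(1)}+e_i^{(2)}\big)^\perp,\quad \alpha_i=\tfrac{L^2}{2}C_\perp\big(e_i^{(2)}\big)^\perp,$$ $$d_i=\tfrac{L^2(C_\parallel-C_\perp)}{2}\Big[\big((e_i^{(1)})^\perp\cdot e_{\neg i}^{(1)}\big)e_{\neg i}^{(1)}+\big((e_i^{(2)})^\perp\cdot e_{\neg i}^{(2)}\big)e_{\neg i}^{(2)}\Big]+b_i,$$ $$\omega=\tfrac{2L^3C_\perp}{3},\quad \varpi=\tfrac{L^3C_\perp}{3}\big[e_1^{(1)}\cdot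 e_2^{(1)}+e_1^{(2)}\cdot e_2^{(2)}\big],\quad \beta=\tfrac{L^3C_\perp}{3}\,e_1^{(2)}\cdot e_2^{(2)}.$$ Then $$\mathcal R=\begin{pmatrix}A_1&b_1&-\lambda A_2&-\lambda b_2\\ b_1^\top&\omega&-\lambda d_1^\top&-\lambda\varpi\\ -\lambda A_1&-\lambda b_1&A_2&b_2\\ -\lambda d_2^\top&-\lambda\varpi&b_2^\top&\omega\end{pmatrix}\in\mathbb{R}^{6\times6},\quad \phi_1=\begin{pmatrix}\alpha_1\\ \omega/2\\ -\lambda\alpha_1\\ -\lambda\beta\end{pmatrix},\quad \phi_2=\begin{pmatrix}-\lambda\alpha_2\\ -\lambda\beta\\ \alpha_2\\ \omega/2\end{pmatrix}\in\mathbb{R}^6,$$ and the control vector fields on $\mathbb{R}^8$ are $$v_1=\begin{pmatrix}-\mathcal R^{-1}\phi_1\\ 1\\ 0\end{pmatrix},\qquad v_2=\begin{pmatrix}-\mathcal R^{-1}\phi_2\\ 0\\ 1\end{pmatrix},$$ all functions of $(\theta_1,\theta_2,\sigma_1,\sigma_2)$ and of the parameter $\lambda$. (The vectors $\phi_1,\phi_2$ are unrelated to the phase $\phi$.) *)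

(* Defs.v *)
From HB Require Import structures.
From mathcomp Require Import all_boot all_order all_algebra.
From mathcomp Require Import all_classical all_reals all_analysis.
Import Order.TTheory GRing.Theory Num.Theory.
Import numFieldNormedType.Exports.

Set Implicit Arguments.
Unset Strict Implicit.
Unset Printing Implicit Defensive.

Local Open Scope classical_set_scope.
Local Open Scope ring_scope.

Definition vec2 {R : realType} (a b : R) : 'cV[R]_2 :=
  \col_(k < 2) nth 0 [:: a; b] k.

Definition perp {R : realType} (v : 'cV[R]_2) : 'cV[R]_2 :=
  vec2 (- v 1 0) (v 0 0).

Definition dot {R : realType} (u v : 'cV[R]_2) : R := (u^T *m v) 0 0.

(* Direction of the j-th link (j = 1, 2) of a scallop with orientation th and
   opening angle sg. *)
Definition e {R : realType} (th sg : R) (j : nat) : 'cV[R]_2 :=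
  vec2 (cos (th + (j.-1)%:R * sg)) (sin (th + (j.-1)%:R * sg)).

Definition E {R : realType} (th sg : R) (j : nat) : 'M[R]_2 :=
  e th sg j *m (e th sg j)^T.

Definition A {R : realType} (L Cpar Cperp th sg : R) : 'M[R]_2 :=
  L *: ((2 * Cperp) *: 1%:M + (Cpar - Cperp) *: (E th sg 1 + E th sg 2)).

Definition b {R : realType} (L Cperp th sg : R) : 'cV[R]_2 :=
  (L ^+ 2 / 2 * Cperp) *: perp (e th sg 1 + e th sg 2).

Definition alpha {R : realType} (L Cperp th sg : R) : 'cV[R]_2 :=
  (L ^+ 2 / 2 * Cperp) *: perp (e th sg 2).

(* (th, sg) are the angles of the i-th scallop, (th', sg') those of the other
   one. *)
Definition d {R : realType} (L Cpar Cperp th sg th' sg' : R) : 'cV[R]_2 :=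
  (L ^+ 2 * (Cpar - Cperp) / 2) *:
    (dot (perp (e th sg 1)) (e th' sg' 1) *: e th' sg' 1
     + dot (perp (e th sg 2)) (e th' sg' 2) *: e th' sg' 2)
  + b L Cperp th sg.

Definition omega {R : realType} (L Cperp : R) : R := 2 * L ^+ 3 * Cperp / 3.

Definition varpi {R : realType} (L Cperp th1 th2 sg1 sg2 : R) : R :=
  L ^+ 3 * Cperp / 3 *
    (dot (e th1 sg1 1) (e th2 sg2 1) + dot (e th1 sg1 2) (e th2 sg2 2)).

Definition beta {R : realType} (L Cperp th1 th2 sg1 sg2 : R) : R :=
  L ^+ 3 * Cperp / 3 * dot (e th1 sg1 2) (e th2 sg2 2).

(* The 6x6 matrix, as a 2x2 array of 3x3 blocks, each split as 2 + 1. *)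
Definition resistance {R : realType} (L Cpar Cperp lam th1 th2 sg1 sg2 : R) :
    'M[R]_6 :=
  let A1 := A L Cpar Cperp th1 sg1 in
  let A2 := A L Cpar Cperp th2 sg2 in
  let b1 := b L Cperp th1 sg1 in
  let b2 := b L Cperp th2 sg2 in
  let d1 := d L Cpar Cperp th1 sg1 th2 sg2 in
  let d2 := d L Cpar Cperp th2 sg2 th1 sg1 in
  let om : 'M[R]_1 := (omega L Cperp)%:M in
  let vp : 'M[R]_1 := (varpi L Cperp th1 th2 sg1 sg2)%:M in
  block_mx
    (block_mx A1 b1
              b1^T om)
    (block_mx (- lam *: A2) (- lam *: b2)
              (- lam *: d1^T) (- lam *: vp))
    (block_mx (- lam *: A1) (- lam *: b1)
              (- lam *: d2^T) (- lam *: vp))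
    (block_mx A2 b2
              b2^T om).

Definition phi1 {R : realType} (L Cperp lam th1 th2 sg1 sg2 : R) : 'cV[R]_6 :=
  let a1 := alpha L Cperp th1 sg1 in
  col_mx (col_mx a1 (omega L Cperp / 2)%:M)
         (col_mx (- lam *: a1) (- lam * beta L Cperp th1 th2 sg1 sg2)%:M).

Definition phi2 {R : realType} (L Cperp lam th1 th2 sg1 sg2 : R) : 'cV[R]_6 :=
  let a2 := alpha L Cperp th2 sg2 in
  col_mx (col_mx (- lam *: a2) (- lam * beta L Cperp th1 th2 sg1 sg2)%:M)
         (col_mx a2 (omega L Cperp / 2)%:M).

(* States z = (x1, theta1, x2, theta2, sigma1, sigma2) as columns of R^8. *)
Definition mkstate {R : realType} (x1 : 'cV[R]_2) (th1 : R)
    (x2 : 'cV[R]_2) (th2 sg1 sg2 : R) : 'cV[R]_8 :=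
  \col_(k < 8) nth 0 [:: x1 0 0; x1 1 0; th1; x2 0 0; x2 1 0; th2; sg1; sg2] k.

Definition pos1 {R : realType} (z : 'cV[R]_8) : 'cV[R]_2 :=
  vec2 (z (inord 0) 0) (z (inord 1) 0).
Definition theta1 {R : realType} (z : 'cV[R]_8) : R := z (inord 2) 0.
Definition pos2 {R : realType} (z : 'cV[R]_8) : 'cV[R]_2 :=
  vec2 (z (inord 3) 0) (z (inord 4) 0).
Definition theta2 {R : realType} (z : 'cV[R]_8) : R := z (inord 5) 0.
Definition sigma1 {R : realType} (z : 'cV[R]_8) : R := z (inord 6) 0.
Definition sigma2 {R : realType} (z : 'cV[R]_8) : R := z (inord 7) 0.

Definition v1 {R : realType} (L Cpar Cperp lam : R) (z : 'cV[R]_8) :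
    'cV[R]_8 :=
  col_mx
    (- (invmx (resistance L Cpar Cperp lam
                 (theta1 z) (theta2 z) (sigma1 z) (sigma2 z))
        *m phi1 L Cperp lam (theta1 z) (theta2 z) (sigma1 z) (sigma2 z)))
    (vec2 1 0).

Definition v2 {R : realType} (L Cpar Cperp lam : R) (z : 'cV[R]_8) :
    'cV[R]_8 :=
  col_mx
    (- (invmx (resistance L Cpar Cperp lam
                 (theta1 z) (theta2 z) (sigma1 z) (sigma2 z))
        *m phi2 L Cperp lam (theta1 z) (theta2 z) (sigma1 z) (sigma2 z)))
    (vec2 0 1).

Definition lie_bracket {R : realType} (X Y : 'cV[R]_8 -> 'cV[R]_8)
    (z : 'cV[R]_8) : 'cV[R]_8 :=
  'd Y z (X z) - 'd X z (Y z).

Definition z0 {R : realType} (x1 x2 : 'cV[R]_2) (th0 phi eps : R) :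
    'cV[R]_8 :=
  mkstate x1 th0 x2 th0 (pi + eps) (pi + eps * cos phi).

(* The fields do not depend on the hinge positions, so neither does the value
   of the bracket; the positions are set to 0. *)
Definition v3 {R : realType} (L Cpar Cperp lam th0 phi eps : R) : 'cV[R]_8 :=
  lie_bracket (v1 L Cpar Cperp lam) (v2 L Cpar Cperp lam)
    (z0 0 0 th0 phi eps).

Definition u1 {R : realType} (gamma1 tau t : R) : R :=
  if t < tau then 0
  else if t < 2 * tau then - gamma1
  else if t < 3 * tau then 0
  else gamma1.

Definition u2 {R : realType} (gamma2 tau t : R) : R :=
  if t < tau then - gamma2
  else if t < 2 * tau then 0
  else if t < 3 * tau then gamma2
  else 0.

(* Solution on [0, 4 tau] for the piecewise constant controls: continuous, with
   the equation holding away from the switching times. *)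
Definition is_solution {R : realType} (L Cpar Cperp lam gamma1 gamma2 : R)
    (zinit : 'cV[R]_8) (tau : R) (z : R -> 'cV[R]_8) : Prop :=
  [/\ {within `[0, 4 * tau], continuous z},
      z 0 = zinit &
      forall t : R, 0 < t < 4 * tau ->
        t != tau -> t != 2 * tau -> t != 3 * tau ->
        is_derive t 1 z
          (u1 gamma1 tau t *: v1 L Cpar Cperp lam (z t)
           + u2 gamma2 tau t *: v2 L Cpar Cperp lam (z t))].

(* The columns (xi_i, eta_i) and the common value of vartheta_1, vartheta_2. *)
Definition xieta1 {R : realType} (L Cpar Cperp lam th0 phi : R) : 'cV[R]_2 :=
  (L * lam * sin (phi / 2) ^+ 2 / (64 * Cpar * Cperp * (1 - lam ^+ 2))
   * ((Cperp ^+ 2 * (2 + lam) - Cpar * Cperp)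
      + cos phi * (3 * Cpar ^+ 2 - 2 * Cperp * Cpar - Cperp ^+ 2)))
  *: vec2 (cos th0) (sin th0).

Definition xieta2 {R : realType} (L Cpar Cperp lam th0 phi : R) : 'cV[R]_2 :=
  (L * lam * sin (phi / 2) ^+ 2 / (64 * Cpar * Cperp * (1 - lam ^+ 2))
   * ((3 * Cpar ^+ 2 - 2 * Cpar * Cperp - Cperp ^+ 2)
      + cos phi * (Cperp ^+ 2 * (2 + lam) - Cperp * Cpar)))
  *: vec2 (cos th0) (sin th0).

Definition vartheta {R : realType} (lam phi : R) : R :=
  - (lam / (16 * (1 - lam))) * sin (phi / 2) ^+ 2.

(* Main.v *)
(* Over one stroke of duration [tau] the state moves along a fixed field [W], and
   its position, expanded to second order in [tau] around the initial state, is
   updated by [c W] at first order and by [c DW p + c^2 / 2 DW W] at second order,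
   [p] being the current first-order coefficient. After the four strokes the first
   order cancels and the second order is the Lie bracket.

   For the bracket, the position rows of [R w = - phi] decouple because
   [lam^2 <> 1]: each scallop is force free on its own, and only the two torque
   equations couple them. Differentiating these explicit scalar equations along
   the other control field gives a linear system for the bracket, with the same
   matrix [R]. In the frame rotated by [th0], all its coefficients have explicit
   expansions at [eps = 0], where [R] stays invertible; so an explicit polynomial
   ansatz whose residual is [o(eps^2)] is the expansion of the solution. *)

Require Import Defs.
From mathcomp Require Import all_boot all_order all_algebra.
From mathcomp Require Import all_classical all_reals all_analysis.
From mathcomp Require Import ring lra.
Import Order.TTheory GRing.Theory Num.Theory.
Import numFieldNormedType.Exports.

Set Implicit Arguments.
Unset Strict Implicit.
Unset Printing Implicit Defensive.

Local Open Scope classical_set_scope.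
Local Open Scope ring_scope.

(** The obstacle is the inverse of a 6x6 matrix depending on four angles: neither it nor its
    derivative is ever expanded. Candidates are checked by substitution, and the inverse serves only
    to pass from a small residual to a small error.

    Up to order [eps ^+ 2] the interaction enters the fields only through the angular velocities. A
    straight scallop actuated at unit rate turns its links at the opposite rates -1/2 and 1/2 and
    moves its hinge transversally at speed [L / 4]. At order two each scallop exerts a torque on the
    other, and the mean angular velocities [p], [p'] of the links solve a 2x2 system
    [p = lam * (p' + ...)]; this gives the factors [lam / (1 - lam ^+ 2)] and
    [lam ^+ 2 / (1 - lam ^+ 2)]. These terms must be known, since they contribute to the translation
    part of the bracket at order two.

    Exchanging the scallops exchanges the two fields, hence changes the sign of the bracket. With
    openings [pi + a * eps] and [pi + b * eps] for arbitrary [a], [b], the second half of the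
    bracket computation is therefore the first half up to sign. *)

Lemma within_continuous_post {T U V : topologicalType} (A : set T) (f : T -> U)
    (g : U -> V) :
  {within A, continuous f} -> continuous g -> {within A, continuous (g \o f)}.
Proof.
by move=> fc gc x P /(gc (f x)) /(fc x).
Qed.

(** * Curves followed along piecewise autonomous fields *)

Section ColumnCurves.
Context {R : realType} {n : nat}.
Implicit Types (f df : R -> 'cV[R]_n) (a b : R).

Lemma le_cV_norm (x : 'cV[R]_n) (B : R) :
  0 <= B -> (forall i, `|x i 0| <= B) -> `|x| <= B.
Proof.
move=> B0 h; rewrite [leLHS]/Num.Def.normr/= mx_normrE.
by apply: bigmax_le => // -[i j] _ /=; rewrite (ord1 j).
Qed.

Lemma cV_coord_le_norm (x : 'cV[R]_n) i : `|x i 0| <= `|x|.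
Proof.
rewrite [leRHS]/Num.Def.normr/= mx_normrE.
exact: (le_bigmax _ (fun ij : 'I_n * 'I_1 => `|x ij.1 ij.2|) (i, 0)).
Qed.

Lemma is_derive_coord f (v : 'cV[R]_n) (t : R) i :
  is_derive t 1 f v -> is_derive t 1 (fun s => f s i 0 : R) (v i 0).
Proof.
move=> fv; have fd : derivable f t 1 by exact: ex_derive.
split; first by have /derivable_mxP := fd.
by rewrite -(@derive_val _ _ _ _ _ _ _ fv) derive_mx// mxE.
Qed.

(** The norm of a column is the maximum of its coordinates, so the scalar mean value theorem in each
    coordinate gives the bound without a dimensional factor. *)
Lemma mean_value_le f df a b B : a <= b ->
  (forall t, a < t < b -> is_derive t 1 f (df t)) ->
  {within `[a, b], continuous f} ->
  (forall t, a < t < b -> `|df t| <= B) ->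
  `|f b - f a| <= B * (b - a).
Proof.
move=> ab fdf fc dfB; have [ab'|ba] := ltP a b; last first.
  have -> : b = a by apply/eqP; rewrite eq_le ab ba.
  by rewrite !subrr normr0 mulr0.
have B0 : 0 <= B.
  apply: (le_trans (normr_ge0 (df ((a + b) / 2)))); apply: dfB.
  by apply/andP; split; [rewrite midf_lt|rewrite midf_lt].
apply: le_cV_norm => [|i]; first by rewrite mulr_ge0// subr_ge0.
have [||c cab e] := @MVT R (fun t => f t i 0) (fun t => df t i 0) a b ab'.
- by move=> t tab; apply: is_derive_coord; apply: fdf; rewrite in_itv /= in tab.
- apply: (@within_continuous_post _ _ _ _ f (fun M : 'cV[R]_n => M i 0)) => //.
  exact: coord_continuous.
rewrite !mxE e normrM (@ger0_norm _ (b - a)) ?subr_ge0//.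
apply: ler_wpM2r; first by rewrite subr_ge0.
by apply: le_trans (cV_coord_le_norm _ _) _; apply: dfB; rewrite in_itv /= in cab.
Qed.

(* First exit time argument: the speed bound is only available inside the ball. *)
Lemma confined_in_ball f df a b c r M : a <= b -> 0 <= M ->
  (forall t, a < t < b -> is_derive t 1 f (df t)) ->
  {within `[a, b], continuous f} ->
  (forall t, a < t < b -> `|f t - c| < r -> `|df t| <= M) ->
  `|f a - c| + M * (b - a) < r ->
  forall t, a <= t <= b -> `|f t - c| <= `|f a - c| + M * (b - a).
Proof.
move=> ab M0 fdf fc dfM ar.
have step t : a <= t <= b -> (forall s, a < s < t -> `|f s - c| < r) ->
    `|f t - c| <= `|f a - c| + M * (b - a).
  move=> /andP[at_ tb] h.
  have : `|f t - f a| <= M * (t - a).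
    apply: (@mean_value_le _ df) => //.
    - by move=> s /andP[as_ st]; apply: fdf; rewrite as_ (lt_le_trans st).
    - apply: continuous_subspaceW fc => s /=; rewrite !in_itv /= => /andP[-> st] /=.
      exact: le_trans st tb.
    - move=> s ast; apply: dfM; last exact: h.
      by case/andP: ast => -> st /=; rewrite (lt_le_trans st).
  move=> h1; rewrite -(subrKA (f a)) (le_trans (ler_normD _ _))// addrC lerD2l.
  by apply: (le_trans h1); rewrite ler_wpM2l// lerD2r.
have inside t : a <= t <= b -> `|f t - c| < r.
  move=> atb; rewrite ltNge; apply/negP => tr.
  pose S := `[a, b] `&` [set s | r <= `|f s - c|].
  have Sclosed : compact S.
    have gc : {within `[a, b], continuous (fun s => `|f s - c|)}.
      apply: (@within_continuous_post _ _ _ _ f (fun x : 'cV[R]_n => `|x - c|)) => //.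
      move=> x; apply: continuous_comp; last exact: norm_continuous.
      by apply: continuousB; [exact: cvg_id|exact: cst_continuous].
    apply: (@subclosed_compact _ _ `[a, b]).
    - have /continuous_closedP/(_ [set x | r <= x] (@closed_ge _ r)) := gc.
      move=> /closed_subspaceP[U Ucl UE].
      rewrite /S setIC [X in X `&` _](_ : _ = (fun s => `|f s - c|) @^-1` [set y | r <= y])//.
      by rewrite -UE; apply: closedI => //; exact: interval_closed.
    - exact: segment_compact.
    - by move=> s [].
  (* [T] is the first time at distance at least [r]. Before it the speed bound is available, so
     [step] applies up to [T] and puts the curve strictly inside the ball at [T], a
     contradiction. *)
  have [||T TS Tmin] := @compact_EVT_min _ R id S _ Sclosed.
  - by exists t; split => //=; rewrite in_itv.
  - by apply: continuous_subspaceT => x; exact: cvg_id.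
  move: TS; rewrite inE => -[/=]; rewrite in_itv/= => aTb rT.
  have /step : forall s, a < s < T -> `|f s - c| < r.
    move=> s /andP[as_ sT]; rewrite ltNge; apply/negP => rs.
    have : T <= s.
      apply: Tmin; rewrite inE; split => //=; rewrite in_itv /= (ltW as_) /=.
      by rewrite (le_trans (ltW sT))//; case/andP: aTb.
    by rewrite leNgt sT.
  by move=> /(_ aTb) /le_lt_trans /(_ ar); rewrite ltNge rT.
move=> t tab; apply: step => // s /andP[as_ st]; apply: inside.
by rewrite (ltW as_) /= (le_trans (ltW st))//; case/andP: tab.
Qed.

End ColumnCurves.

Lemma differentiable_remainder {R : realType} {V W : normedModType R}
    (F : V -> W) (x0 : V) : differentiable F x0 ->
  forall eta, 0 < eta -> exists2 r, 0 < r & forall x, `|x - x0| < r ->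
    `|F x - F x0 - 'd F x0 (x - x0)| <= eta * `|x - x0|.
Proof.
move=> /diff_locally /eqaddoP dF eta eta0.
have /nbhs_ballP[r /= r0 hr] := dF _ eta0.
exists r => // x xr.
have /hr : ball (0 : V) r (x - x0) by rewrite -ball_normE /= sub0r normrN.
rewrite /= !fctE /= subrK.
by rewrite opprD addrA.
Qed.

(** Both sides are directional derivatives, and the period [h] of [F] makes their difference
    quotients equal. *)
Lemma diff_translation_invariant {R : realType} {n : nat} (F : 'cV[R]_n -> 'cV[R]_n)
    (h z v : 'cV[R]_n) :
  (forall y, differentiable F y) -> (forall y, F (y + h) = F y) ->
  'd F (z + h) v = 'd F z v.
Proof.
move=> dF Fh.
apply: (eq_trans (esym (deriveE v (dF (z + h))))); apply: (eq_trans _ (deriveE v (dF z))).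
rewrite /derive; apply: congr1; apply: (congr1 (fun g : R -> 'cV[R]_n => g @ 0^')).
by apply/funext => r /=; rewrite addrA !Fh.
Qed.

Lemma is_derive_cV {R : realType} {n : nat} (f : R -> 'cV[R]_n) (v : 'cV[R]_n)
    (t : R) :
  (forall i, is_derive t 1 (fun s => f s i 0 : R) (v i 0)) -> is_derive t 1 f v.
Proof.
move=> h; have fd : derivable f t 1.
  by apply/derivable_mxP => i j; rewrite (ord1 j); have [] := h i.
split=> //; rewrite derive_mx//; apply/matrixP => i j; rewrite (ord1 j) mxE.
exact: (@derive_val _ _ _ _ _ _ _ (h i)).
Qed.

(** Reduces a differential on columns to scalar derivatives along a line, where the usual
    differentiation rules apply. *)
Lemma is_derive_along {R : realType} {n : nat} (F : 'cV[R]_n -> 'cV[R]_n) (z h : 'cV[R]_n) i :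
  differentiable F z ->
  is_derive (0 : R) 1 (fun r => F (z + r *: h) i 0 : R) ('d F z h i 0).
Proof.
move=> dF; apply: (is_derive_coord (f := fun r => F (z + r *: h))).
have hD : derivable F z h by exact: diff_derivable.
have <- : 'D_h F z = 'd F z h by exact: deriveE.
have -> : (fun r : R => F (z + r *: h)) = (fun r : R => F (r *: h + z)).
  by apply/funext => r; rewrite addrC.
split; first exact: (derivable1P F z h).1 hD.
rewrite /derive; apply: congr1; apply: (congr1 (fun g : R -> 'cV[R]_n => g @ 0^')).
by apply/funext => r /=; rewrite addr0 scale0r add0r [_%:A]mulr1.
Qed.

Lemma is_derive_quadratic {R : realType} {n : nat} (v0 v1 v2 : 'cV[R]_n) (s t : R) :
  is_derive t 1 (fun t => v0 + (t - s) *: v1 + ((t - s) ^+ 2 / 2) *: v2)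
    (v1 + (t - s) *: v2).
Proof.
apply: is_derive_cV => i.
under eq_fun do rewrite !mxE.
apply: is_derive_eq.
rewrite /GRing.scale /= !mxE; field.
Unshelve. by [].
Qed.

(** * Second-order expansion over one stroke *)

Section Stage.
Context {R : realType} {n : nat}.
Local Notation V := ('cV[R]_n).

Definition osmall (k : nat) (f : R -> V) :=
  forall e, 0 < e -> \forall t \near 0^'+, `|f t| <= e * t ^+ k.

(* Every expansion is centred at the fixed point [zi], so differentiability of
   [W] at [zi] alone is enough. *)
Lemma osmall_stage (W : V -> V) (zi p q : V) (c : R) (a : R -> R)
    (z : R -> R -> V) :
  differentiable W zi ->
  (\forall tau \near 0^'+,
     {within `[a tau, a tau + tau], continuous (z tau)} /\
     (forall t, a tau < t < a tau + tau ->
        is_derive t 1 (z tau) (c *: W (z tau t)))) ->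
  osmall 2 (fun tau => z tau (a tau) - (zi + tau *: p + tau ^+ 2 *: q)) ->
  osmall 2 (fun tau => z tau (a tau + tau) -
    (zi + tau *: (p + c *: W zi) +
     tau ^+ 2 *: (q + c *: 'd W zi p + (c ^+ 2 / 2) *: 'd W zi (W zi)))).
Proof.
move=> dW hz hstart e e0.
have [K K0 hK] := linear_lipschitz (diff_continuous dW).
set D := 'd W zi in hK *.
(* [M] bounds [W] within distance [r <= 1] of [zi]; [C1 * tau] bounds the distance from [zi] during
   the stroke; [C2 * tau ^+ 2] bounds the error of the first-order expansion; [eta] leaves half of
   [e] for the term in [C2]. *)
pose M := `|W zi| + K + 1.
have M0 : 0 < M by rewrite /M; have := normr_ge0 (W zi); lra.
pose C1 := `|p| + `|q| + 1 + `|c| * M.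
have C10 : 0 < C1.
  rewrite /C1; have := normr_ge0 p; have := normr_ge0 q.
  have : 0 <= `|c| * M by rewrite mulr_ge0// ltW.
  lra.
pose eta := Num.min 1 (e / (2 * (1 + `|c| * C1))).
have cC1 : 0 <= `|c| * C1 by rewrite mulr_ge0// ltW.
have eta0 : 0 < eta by rewrite lt_min ltr01 divr_gt0// mulr_gt0//; lra.
have eta1 : eta <= 1 by rewrite ge_min lexx.
have etae : eta * (1 + `|c| * C1) <= e / 2.
  have : eta <= e / (2 * (1 + `|c| * C1)) by rewrite ge_min lexx orbT.
  rewrite ler_pdivlMr; last by rewrite mulr_gt0//; lra.
  lra.
have [r0 r00 hr0] := differentiable_remainder dW eta0.
pose r := Num.min 1 r0.
have r_gt0 : 0 < r by rewrite lt_min ltr01.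
have r1 : r <= 1 by rewrite ge_min lexx.
have hr x : `|x - zi| < r -> `|W x - W zi - D (x - zi)| <= eta * `|x - zi|.
  by move=> h; apply: hr0; apply: lt_le_trans h _; rewrite ge_min lexx orbT.
have hWlip x : `|x - zi| < r -> `|W x - W zi| <= (K + 1) * `|x - zi|.
  move=> h; rewrite -(subrK (D (x - zi)) (W x - W zi)).
  apply: le_trans (ler_normD _ _) _.
  have := hr _ h; have := hK (x - zi).
  have : eta * `|x - zi| <= 1 * `|x - zi| by rewrite ler_wpM2r.
  lra.
have hWM x : `|x - zi| < r -> `|W x| <= M.
  move=> h; rewrite -(subrK (W zi) (W x)).
  apply: le_trans (ler_normD _ _) _.
  have := hWlip _ h.
  have : (K + 1) * `|x - zi| <= (K + 1) * 1.
    by rewrite ler_wpM2l//; [lra|rewrite ltW// (lt_le_trans h)].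
  rewrite /M; lra.
pose C2 := `|q| + 1 + `|c| * ((K + 1) * C1).
have C20 : 0 <= C2.
  rewrite /C2; have := normr_ge0 q.
  have : 0 <= `|c| * ((K + 1) * C1) by rewrite mulr_ge0// mulr_ge0//; lra.
  lra.
have cKC2 : 0 <= `|c| * (K * C2) by rewrite mulr_ge0// mulr_ge0// ltW.
near=> tau.
have tau0 : 0 < tau by near: tau; exact: nbhs_right_gt.
have tau1 : tau <= 1 by near: tau; apply: nbhs_right_le.
have tauC1 : C1 * tau < r.
  rewrite mulrC -ltr_pdivlMr//.
  by near: tau; apply: nbhs_right_lt; rewrite divr_gt0.
have tauC2 : (`|c| * (K * C2)) * tau <= e / 2.
  have : tau <= (e / 2) / (1 + `|c| * (K * C2)).
    by near: tau; apply: nbhs_right_le; rewrite !divr_gt0//; lra.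
  rewrite ler_pdivlMr; last by clear - cKC2; lra.
  by have := ltW tau0; clear; lra.
have [zc zd] : {within `[a tau, a tau + tau], continuous (z tau)} /\
     (forall t, a tau < t < a tau + tau ->
        is_derive t 1 (z tau) (c *: W (z tau t))) by near: tau.
have hs : `|z tau (a tau) - (zi + tau *: p + tau ^+ 2 *: q)| <= eta * tau ^+ 2.
  by near: tau; exact: hstart.
set s := a tau in zc zd hs *; set y := z tau in zc zd hs *.
have tau2 : tau ^+ 2 <= tau by rewrite expr2 ger_pMl.
have tau20 : 0 < tau ^+ 2 by rewrite exprn_gt0.
have ss : s <= s + tau by rewrite lerDl ltW.
have nq : `|tau ^+ 2 *: q| = tau ^+ 2 * `|q| by rewrite normrZ gtr0_norm.
have np : `|tau *: p| = tau * `|p| by rewrite normrZ gtr0_norm.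
have hs1 : `|y s - (zi + tau *: p)| <= (`|q| + 1) * tau ^+ 2.
  rewrite -(subrK (tau ^+ 2 *: q) (y s - (zi + tau *: p))) -[X in X + _]addrA -opprD.
  apply: le_trans (ler_normD _ _) _.
  have : eta * tau ^+ 2 <= 1 * tau ^+ 2 by rewrite ler_wpM2r// ltW.
  by rewrite nq; move: hs; clear; lra.
have hs0 : `|y s - zi| <= (`|p| + `|q| + 1) * tau.
  rewrite -(subrK (tau *: p) (y s - zi)) -[X in X + _]addrA -opprD.
  apply: le_trans (ler_normD _ _) _; rewrite np.
  have : (`|q| + 1) * tau ^+ 2 <= (`|q| + 1) * tau.
    by rewrite ler_wpM2l//; have := normr_ge0 q; clear; lra.
  by move: hs1; clear; lra.
have dt : s + tau - s = tau by ring.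
have conf t : s <= t <= s + tau -> `|y t - zi| <= C1 * tau.
  move=> st; have hh : `|y s - zi| + (`|c| * M) * (s + tau - s) <= C1 * tau.
    by rewrite dt /C1; move: hs0; clear; lra.
  apply: (le_trans _ hh).
  apply: (confined_in_ball (df := fun t => c *: W (y t)) (r := r)) => //.
  - by rewrite mulr_ge0// ltW.
  - by move=> u _ hu; rewrite normrZ ler_wpM2l// hWM.
  - exact: (le_lt_trans hh).
have inr t : s < t < s + tau -> `|y t - zi| < r.
  move=> /andP[st ts]; apply: (le_lt_trans _ tauC1); apply: conf.
  by rewrite (ltW st) (ltW ts).
have subc t : s <= t <= s + tau -> {within `[s, t], continuous y}.
  move=> /andP[st ts]; apply: continuous_subspaceW zc => u /=.
  by rewrite !in_itv/= => /andP[-> ut]; rewrite (le_trans ut).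
(* Comparison with the quadratic curve of velocity [v1 + (u - s) *: v2]. It is used twice, as in
   Picard iteration: with the constant velocity [c *: W zi], then with the affine velocity obtained
   by inserting the first result into the linearized field. *)
have poly_conv (v0 v1 v2 : V) t (B : R) : s <= t <= s + tau -> 0 <= B ->
    (forall u, s < u < t -> `|c *: W (y u) - (v1 + (u - s) *: v2)| <= B) ->
    `|y t - (v0 + (t - s) *: v1 + ((t - s) ^+ 2 / 2) *: v2)| <=
      `|y s - v0| + B * tau.
  move=> st B0 hB; pose P u := v0 + (u - s) *: v1 + ((u - s) ^+ 2 / 2) *: v2.
  have dP (u : R) : is_derive u 1 P (v1 + (u - s) *: v2) by exact: is_derive_quadratic.
  have [ste tse] := andP st.
  have cP : {within `[s, t], continuous P}.
    apply: continuous_subspaceT => u; apply: differentiable_continuous.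
    by apply/derivable1_diffP; exact: ex_derive.
  have Ps : P s = v0 by rewrite /P subrr expr0n mul0r !scale0r !addr0.
  have : `|(y - P) t - (y - P) s| <= B * (t - s).
    apply: (@mean_value_le _ _ _ (fun u => c *: W (y u) - (v1 + (u - s) *: v2))) => //.
    - move=> u /andP[su ut]; have sut : s < u < s + tau by rewrite su (lt_le_trans ut).
      have yu := zd _ sut; have Pu := dP u; exact: is_deriveB.
    - move=> u; apply: continuousB; last exact: cP.
      exact: subc.
  rewrite !fctE Ps => h.
  rewrite -(subrK (y s - v0) (y t - _)); apply: le_trans (ler_normD _ _) _.
  rewrite [leRHS]addrC lerD2r; apply: le_trans h _.
  by rewrite ler_wpM2l// lerBlDl.
have hf1 t : s <= t <= s + tau ->
    `|y t - (zi + tau *: p + (t - s) *: (c *: W zi))| <= C2 * tau ^+ 2.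
  move=> st.
  have := @poly_conv (zi + tau *: p) (c *: W zi) 0 t (`|c| * ((K + 1) * (C1 * tau))) st.
  rewrite scaler0 addr0 => h.
  apply: le_trans (h _ _) _.
    by rewrite mulr_ge0// mulr_ge0 ?mulr_ge0// ltW//; have := K0; clear; lra.
    move=> u /andP[su ut]; rewrite scaler0 addr0 -scalerBr normrZ ler_wpM2l//.
    have sut : s < u < s + tau by rewrite su (lt_le_trans ut)//; case/andP: st.
    apply: le_trans (hWlip _ (inr _ sut)) _.
    by rewrite ler_wpM2l//; [have := K0; clear; lra|apply: conf; case/andP: sut => /ltW-> /ltW->].
  rewrite /C2; apply: le_trans (lerD hs1 (lexx _)) _.
  by rewrite le_eqVlt; apply/orP; left; apply/eqP; ring.
have := @poly_conv (zi + tau *: p + tau ^+ 2 *: q) (c *: (W zi + tau *: D p))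
  (c ^+ 2 *: D (W zi)) (s + tau)
  (`|c| * (eta * (C1 * tau) + K * (C2 * tau ^+ 2))).
rewrite dt => h.
have -> : y (s + tau) - (zi + tau *: (p + c *: W zi) +
     tau ^+ 2 *: (q + c *: D p + (c ^+ 2 / 2) *: D (W zi))) =
  y (s + tau) - (zi + tau *: p + tau ^+ 2 *: q + tau *: (c *: (W zi + tau *: D p)) +
     (tau ^+ 2 / 2) *: (c ^+ 2 *: D (W zi))).
  by apply/matrixP => i j; rewrite !mxE; field.
apply: le_trans (h _ _ _) _.
- by rewrite ss lexx.
- by rewrite mulr_ge0// addr_ge0// mulr_ge0 ?mulr_ge0// ltW.
- move=> u sut.
  have sut' : s <= u <= s + tau by case/andP: sut => /ltW-> /ltW->.
  (* The velocity error splits into the remainder of [W] at [y u], at most [eta * (C1 * tau)], and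
     the image under [D] of the first-order position error, at most [K * (C2 * tau ^+ 2)]. *)
  have -> : c *: W (y u) - (c *: (W zi + tau *: D p) + (u - s) *: (c ^+ 2 *: D (W zi)))
    = c *: ((W (y u) - W zi - D (y u - zi)) +
            D (y u - (zi + tau *: p + (u - s) *: (c *: W zi)))).
    have -> : D (y u - (zi + tau *: p + (u - s) *: (c *: W zi))) =
      D (y u - zi) - (tau *: D p + (u - s) *: (c *: D (W zi))).
      rewrite -[zi + _ + _]addrA opprD addrA [LHS]linearB; congr (_ - _).
      rewrite [LHS]linearD; congr (_ + _); first by rewrite linearZ.
      by rewrite linearZ; congr (_ *: _); rewrite linearZ.
    move: (D (y u - zi)) (D p) (D (W zi)) => w1 w2 w3.
    by apply/matrixP => i j; rewrite !mxE; ring.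
  rewrite normrZ ler_wpM2l//; apply: le_trans (ler_normD _ _) _; apply: lerD.
    apply: le_trans (hr _ (inr _ sut)) _.
    by rewrite ler_wpM2l//; [exact: ltW|exact: conf].
  apply: le_trans (hK _) _; rewrite ler_wpM2l//; [exact: ltW|exact: hf1].
- apply: le_trans (lerD hs (lexx _)) _.
  have -> : eta * tau ^+ 2 + `|c| * (eta * (C1 * tau) + K * (C2 * tau ^+ 2)) * tau =
    (eta * (1 + `|c| * C1) + (`|c| * (K * C2)) * tau) * tau ^+ 2 by ring.
  by rewrite ler_wpM2r//; [exact: ltW|have := etae; have := tauC2; clear; lra].
Unshelve. all: by end_near.
Qed.

End Stage.

(** * Composition of the four strokes *)

Section Loop.
Context {R : realType} {n : nat}.
Local Notation V := ('cV[R]_n).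

Definition followed (W : V -> V) (c a b : R) (y : R -> V) :=
  {within `[a, b], continuous y} /\
  (forall t, a < t < b -> is_derive t 1 y (c *: W (y t))).

(** The first-order coefficient runs through [0], [- g2 W2], [- g2 W2 - g1 W1], [- g1 W1], [0]. At
    second order each term [DWi Wi] gets the total weight 1/2 - 1 + 1/2 = 0, and only the mixed
    terms survive. *)
Lemma osmall_loop (W1 W2 : V -> V) (zi : V) (g1 g2 : R) (z : R -> R -> V) :
  differentiable W1 zi -> differentiable W2 zi ->
  (\forall tau \near 0^'+, [/\ z tau 0 = zi,
      followed W2 (- g2) 0 tau (z tau),
      followed W1 (- g1) tau (2 * tau) (z tau),
      followed W2 g2 (2 * tau) (3 * tau) (z tau) &
      followed W1 g1 (3 * tau) (4 * tau) (z tau)]) ->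
  osmall 2 (fun tau => z tau (4 * tau) -
    (zi - (g1 * g2 * tau ^+ 2) *: ('d W2 zi (W1 zi) - 'd W1 zi (W2 zi)))).
Proof.
move=> d1 d2 hz.
have h0 : osmall 2 (fun tau => z tau 0 - (zi + tau *: 0 + tau ^+ 2 *: 0)).
  move=> e e0; near=> tau.
  have -> : z tau 0 = zi by near: tau; apply: filterS hz => tau [].
  by rewrite !scaler0 !addr0 subrr normr0 mulr_ge0 ?exprn_ge0// ltW.
have /(osmall_stage d2)/(_ h0) h1 : \forall tau \near 0^'+,
    followed W2 (- g2) 0 (0 + tau) (z tau).
  by apply: filterS hz => tau [_ + _ _ _]; rewrite add0r.
have /(osmall_stage d1)/(_ h1) h2 : \forall tau \near 0^'+,
    followed W1 (- g1) (0 + tau) (0 + tau + tau) (z tau).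
  by apply: filterS hz => tau [_ _ + _ _]; rewrite add0r mulr_natl mulr2n.
have /(osmall_stage d2)/(_ h2) h3 : \forall tau \near 0^'+,
    followed W2 g2 (0 + tau + tau) (0 + tau + tau + tau) (z tau).
  by apply: filterS hz => tau [_ _ _ + _]; rewrite add0r !mulr_natl !mulrSr mulr0n !add0r.
have /(osmall_stage d1)/(_ h3) h4 : \forall tau \near 0^'+,
    followed W1 g1 (0 + tau + tau + tau) (0 + tau + tau + tau + tau) (z tau).
  by apply: filterS hz => tau [_ _ _ _]; rewrite add0r !mulr_natl !mulrSr mulr0n !add0r.
move=> e e0; have := h4 e e0; apply: filterS => tau.
have -> : 0 + tau + tau + tau + tau = 4 * tau by ring.
congr (`|_| <= _); congr (_ - _).
have lin1 (D : {linear V -> V}) (x : R) (u : V) : D (0 + x *: u) = x *: D u.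
  by rewrite add0r linearZ.
have lin2 (D : {linear V -> V}) (x y : R) (u v : V) :
    D (0 + x *: u + y *: v) = x *: D u + y *: D v.
  by rewrite linearD lin1; congr (_ + _); rewrite linearZ.
have lin3 (D : {linear V -> V}) (x y c : R) (u v w : V) :
    D (0 + x *: u + y *: v + c *: w) = x *: D u + y *: D v + c *: D w.
  by rewrite linearD lin2; congr (_ + _); rewrite linearZ.
move: ('d W1 zi) ('d W2 zi) => D1 D2.
rewrite lin3 lin2 lin1 linear0.
move: (D1 (W1 zi)) (D1 (W2 zi)) (D2 (W1 zi)) (D2 (W2 zi)) => x11 x12 x21 x22.
by apply/matrixP => i j; rewrite !mxE; field.
Unshelve. all: by end_near.
Qed.

End Loop.

(** * Differentiability of matrix-valued functions *)

Section EntrywiseDifferentiability.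
Context {R : realType} {V : normedModType R}.
Variable x : V.

Lemma differentiable_big_sum (I : Type) (r : seq I) (P : pred I)
    (f : I -> V -> R) :
  (forall i, differentiable (f i) x) ->
  differentiable (fun y => \sum_(i <- r | P i) f i y) x.
Proof.
move=> df; elim: r => [|i r IH].
  by under eq_fun do rewrite big_nil; exact: differentiable_cst.
under eq_fun do rewrite big_cons.
by case: (P i) => //; exact: (differentiableD (df i) IH).
Qed.

Lemma differentiable_big_prod (I : Type) (r : seq I) (P : pred I)
    (f : I -> V -> R) :
  (forall i, differentiable (f i) x) ->
  differentiable (fun y => \prod_(i <- r | P i) f i y) x.
Proof.
move=> df; elim: r => [|i r IH].
  by under eq_fun do rewrite big_nil; exact: differentiable_cst.
under eq_fun do rewrite big_cons.
by case: (P i) => //; exact: (differentiableM (df i) IH).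
Qed.

Definition mxdiff m n (M : V -> 'M[R]_(m, n)) :=
  forall i j, differentiable (fun y => M y i j : R) x.

Lemma mxdiff_cst m n (M : 'M[R]_(m, n)) : mxdiff (fun=> M).
Proof. by move=> i j; exact: differentiable_cst. Qed.

Lemma mxdiffD m n (M N : V -> 'M[R]_(m, n)) :
  mxdiff M -> mxdiff N -> mxdiff (fun y => M y + N y).
Proof.
move=> dM dN i j; under eq_fun do rewrite mxE.
exact: (differentiableD (dM i j) (dN i j)).
Qed.

Lemma mxdiffZ m n (k : V -> R) (M : V -> 'M[R]_(m, n)) :
  differentiable k x -> mxdiff M -> mxdiff (fun y => k y *: M y).
Proof.
move=> dk dM i j; under eq_fun do rewrite mxE.
exact: (differentiableM dk (dM i j)).
Qed.

Lemma mxdiffZc m n (k : R) (M : V -> 'M[R]_(m, n)) :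
  mxdiff M -> mxdiff (fun y => k *: M y).
Proof. by apply: mxdiffZ; exact: differentiable_cst. Qed.

Lemma mxdiffN m n (M : V -> 'M[R]_(m, n)) :
  mxdiff M -> mxdiff (fun y => - M y).
Proof.
move=> dM; under [X in mxdiff X]eq_fun do rewrite -scaleN1r.
exact: mxdiffZc.
Qed.

Lemma mxdiffM m n p (M : V -> 'M[R]_(m, n)) (N : V -> 'M[R]_(n, p)) :
  mxdiff M -> mxdiff N -> mxdiff (fun y => M y *m N y).
Proof.
move=> dM dN i j; under eq_fun do rewrite mxE.
apply: differentiable_big_sum => k.
exact: (differentiableM (dM i k) (dN k j)).
Qed.

Lemma mxdiff_tr m n (M : V -> 'M[R]_(m, n)) :
  mxdiff M -> mxdiff (fun y => (M y)^T).
Proof. by move=> dM i j; under eq_fun do rewrite mxE; exact: dM. Qed.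

Lemma mxdiff_scalar n (k : V -> R) :
  differentiable k x -> mxdiff (fun y => (k y)%:M : 'M[R]_n).
Proof.
move=> dk; under [X in mxdiff X]eq_fun do rewrite -scalemx1.
by apply: mxdiffZ => //; exact: mxdiff_cst.
Qed.

Lemma mxdiff_col m1 m2 n (M : V -> 'M[R]_(m1, n)) (N : V -> 'M[R]_(m2, n)) :
  mxdiff M -> mxdiff N -> mxdiff (fun y => col_mx (M y) (N y)).
Proof.
move=> dM dN i j; under eq_fun do rewrite mxE.
by case: splitP => k _; [exact: dM|exact: dN].
Qed.

Lemma mxdiff_row m n1 n2 (M : V -> 'M[R]_(m, n1)) (N : V -> 'M[R]_(m, n2)) :
  mxdiff M -> mxdiff N -> mxdiff (fun y => row_mx (M y) (N y)).
Proof.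
move=> dM dN i j; under eq_fun do rewrite mxE.
by case: splitP => k _; [exact: dM|exact: dN].
Qed.

Lemma mxdiff_block m1 m2 n1 n2 (Mul : V -> 'M[R]_(m1, n1))
    (Mur : V -> 'M[R]_(m1, n2)) (Mdl : V -> 'M[R]_(m2, n1))
    (Mdr : V -> 'M[R]_(m2, n2)) :
  mxdiff Mul -> mxdiff Mur -> mxdiff Mdl -> mxdiff Mdr ->
  mxdiff (fun y => block_mx (Mul y) (Mur y) (Mdl y) (Mdr y)).
Proof. by move=> *; apply: mxdiff_col; apply: mxdiff_row. Qed.

Lemma differentiable_det n (M : V -> 'M[R]_n) :
  mxdiff M -> differentiable (fun y => \det (M y)) x.
Proof.
move=> dM; apply: differentiable_big_sum => s.
apply: differentiableM; first exact: differentiable_cst.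
by apply: differentiable_big_prod => i; exact: dM.
Qed.

(** By Cramer's rule the inverse is the adjugate over the determinant. Invertibility is assumed at
    every point because [invmx] of a singular matrix is the matrix itself, so the formula would fail
    there. *)
Lemma mxdiff_inv n (M : V -> 'M[R]_n) :
  (forall y, M y \in unitmx) -> mxdiff M -> mxdiff (fun y => invmx (M y)).
Proof.
move=> uM dM; have -> : (fun y => invmx (M y)) =
    (fun y => (\det (M y))^-1 *: \adj (M y)).
  by apply/funext => y; rewrite /invmx uM.
apply: mxdiffZ.
  apply: differentiableV; first exact: differentiable_det.
  by have := uM x; rewrite unitmxE unitfE.
move=> i j; under eq_fun do rewrite mxE.
apply: differentiableM; first exact: differentiable_cst.
apply: differentiable_det => k l; under eq_fun do rewrite !mxE.
exact: dM.
Qed.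

Lemma mxdiff_differentiable m n (M : V -> 'M[R]_(m, n)) :
  mxdiff M -> differentiable M x.
Proof.
move=> dM; have -> : M = \sum_(ij : 'I_m * 'I_n)
    (fun y => M y ij.1 ij.2 *: delta_mx ij.1 ij.2).
  apply/funext => y; rewrite fct_sumE [LHS]matrix_sum_delta.
  by rewrite pair_bigA.
elim/big_ind: _ => [|f g df dg|[i j] _ /=].
- exact: differentiable_cst.
- exact: differentiableD.
- by apply: differentiableZl; exact: dM.
Qed.

Lemma mxdiff_vec2 (f g : V -> R) :
  differentiable f x -> differentiable g x ->
  mxdiff (fun y => vec2 (f y) (g y)).
Proof.
move=> df dg i j; under eq_fun do rewrite mxE.
by case: i => [[|[|]]].
Qed.

Lemma mxdiff_perp (f : V -> 'cV[R]_2) :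
  mxdiff f -> mxdiff (fun y => perp (f y)).
Proof.
move=> df; apply: mxdiff_vec2; last exact: df.
by apply: differentiableN; exact: df.
Qed.

Lemma differentiable_dot (f g : V -> 'cV[R]_2) :
  mxdiff f -> mxdiff g -> differentiable (fun y => dot (f y) (g y)) x.
Proof. by move=> df dg; apply: (mxdiffM (mxdiff_tr df) dg). Qed.

Lemma mxdiff_e (th sg : V -> R) j :
  differentiable th x -> differentiable sg x ->
  mxdiff (fun y => e (th y) (sg y) j).
Proof.
move=> dth dsg.
have da : differentiable (fun y => th y + (j.-1)%:R * sg y) x.
  have d1 : differentiable (cst ((j.-1)%:R : R)) x by exact: differentiable_cst.
  exact: (differentiableD dth (differentiableM d1 dsg)).
apply: mxdiff_vec2.
  apply: (differentiable_comp da); apply/derivable1_diffP.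
  by have [] := is_derive_cos (th x + (j.-1)%:R * sg x).
apply: (differentiable_comp da); apply/derivable1_diffP.
by have [] := is_derive_sin (th x + (j.-1)%:R * sg x).
Qed.

End EntrywiseDifferentiability.

(** * Second-order expansions at 0 *)

Lemma one_sub_cos {R : realType} (x : R) : 1 - cos x = 2 * sin (x / 2) ^+ 2.
Proof.
rewrite [in LHS](_ : x = (x / 2) *+ 2); last by rewrite mulr2n -splitr.
by rewrite cos_mulr2n cos2sin2; ring.
Qed.

Lemma cos_pi_add {R : realType} (x : R) : cos (pi + x) = - cos x.
Proof. by rewrite addrC cosDpi. Qed.

Lemma sin_pi_add {R : realType} (x : R) : sin (pi + x) = - sin x.
Proof. by rewrite addrC sinDpi. Qed.

Lemma is_derive_cos_affine {R : realType} (a k r : R) :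
  is_derive r 1 (fun r => cos (a + r * k)) (- sin (a + r * k) * k).
Proof.
have h : is_derive r 1 (fun r => a + r * k) k.
  by apply: is_derive_eq; rewrite /GRing.scale /=; ring.
have c := is_derive_cos (a + r * k).
exact: (is_derive1_comp (g := fun r => a + r * k) c h).
Qed.

Lemma is_derive_sin_affine {R : realType} (a k r : R) :
  is_derive r 1 (fun r => sin (a + r * k)) (cos (a + r * k) * k).
Proof.
have h : is_derive r 1 (fun r => a + r * k) k.
  by apply: is_derive_eq; rewrite /GRing.scale /=; ring.
have c := is_derive_sin (a + r * k).
exact: (is_derive1_comp (g := fun r => a + r * k) c h).
Qed.

Section Jets.
Context {R : realType}.
Implicit Types (f g : R -> R) (a b c : R).

(** The remainder is a quotient with limit 0 rather than a Landau symbol, so that sums and products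
    of expansions follow from those of limits. *)
Definition jet f a0 a1 a2 : Prop :=
  (f e - (a0 + a1 * e + a2 * e ^+ 2)) / e ^+ 2 @[e --> 0^'+] --> 0.

Lemma cvg_eq_near f g (l : R) : (\forall e \near 0^'+, g e = f e) ->
  g e @[e --> 0^'+] --> l -> f e @[e --> 0^'+] --> l.
Proof. by move=> fg; apply: cvg_trans; exact: near_eq_cvg. Qed.

Lemma cvgD_right f g a b : f e @[e --> (0 : R)^'+] --> a ->
  g e @[e --> (0 : R)^'+] --> b -> f e + g e @[e --> (0 : R)^'+] --> a + b.
Proof. by move=> fa gb; apply: cvgD. Qed.

Lemma cvgM_right f g a b : f e @[e --> (0 : R)^'+] --> a ->
  g e @[e --> (0 : R)^'+] --> b -> f e * g e @[e --> (0 : R)^'+] --> a * b.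
Proof. by move=> fa gb; apply: cvgM. Qed.

Lemma cvgN_right f a : f e @[e --> (0 : R)^'+] --> a ->
  - f e @[e --> (0 : R)^'+] --> - a.
Proof. by move=> fa; apply: cvgN. Qed.

Lemma cvg_cst_right a : (fun=> a) e @[e --> (0 : R)^'+] --> a.
Proof. exact: cvg_cst. Qed.
Arguments cvg_cst_right : clear implicits.

Lemma cvg_id0 : (e : R) @[e --> (0 : R)^'+] --> (0 : R).
Proof. by apply: cvg_at_right_filter; exact: cvg_id. Qed.

Lemma cvg_sqr0 : e ^+ 2 @[e --> (0 : R)^'+] --> (0 : R).
Proof.
have := cvgM_right cvg_id0 cvg_id0; rewrite mulr0; apply: cvg_eq_near.
by near=> e; rewrite /= expr2.
Unshelve. all: by end_near. Qed.

Lemma near_right_neq0 : \forall e \near (0:R)^'+, e != 0.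
Proof. by near=> e; rewrite gt_eqF//. Unshelve. all: by end_near. Qed.

Lemma jet_eq f a0 a1 a2 b0 b1 b2 : a0 = b0 -> a1 = b1 -> a2 = b2 ->
  jet f a0 a1 a2 -> jet f b0 b1 b2.
Proof. by move=> -> -> ->. Qed.

Lemma jet_poly a0 a1 a2 : jet (fun e => a0 + a1 * e + a2 * e ^+ 2) a0 a1 a2.
Proof.
by rewrite /jet; under eq_fun do rewrite subrr mul0r; exact: cvg_cst_right.
Qed.

Lemma jet_cst a : jet (fun=> a) a 0 0.
Proof.
by rewrite /jet; under eq_fun do rewrite !mul0r !addr0 subrr mul0r; exact: cvg_cst_right.
Qed.

Lemma jetD f g a0 a1 a2 b0 b1 b2 : jet f a0 a1 a2 -> jet g b0 b1 b2 ->
  jet (fun e => f e + g e) (a0 + b0) (a1 + b1) (a2 + b2).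
Proof.
move=> jf jg; rewrite /jet -[X in _ --> X](addr0 0).
have := cvgD_right jf jg; apply: cvg_eq_near; near=> e.
by rewrite /= -mulrDl; congr (_ / _); ring.
Unshelve. all: by end_near. Qed.

Lemma jetN f a0 a1 a2 : jet f a0 a1 a2 ->
  jet (fun e => - f e) (- a0) (- a1) (- a2).
Proof.
move=> jf; rewrite /jet -[X in _ --> X]oppr0.
have := cvgN_right jf; apply: cvg_eq_near; near=> e.
by rewrite /= -mulNr; congr (_ / _); ring.
Unshelve. all: by end_near. Qed.

Lemma cvg_poly2 a0 a1 a2 :
  a0 + a1 * e + a2 * e ^+ 2 @[e --> (0:R)^'+] --> a0.
Proof.
have h := cvgD_right (cvgD_right (cvg_cst_right a0) (cvgM_right (cvg_cst_right a1) cvg_id0))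
  (cvgM_right (cvg_cst_right a2) cvg_sqr0).
by move: h; rewrite !mulr0 !addr0; apply.
Qed.
Arguments cvg_poly2 : clear implicits.

Lemma jet_cvg f a0 a1 a2 : jet f a0 a1 a2 -> f e @[e --> 0^'+] --> a0.
Proof.
move=> jf.
have := cvgD_right (cvg_poly2 a0 a1 a2) (cvgM_right jf cvg_sqr0); rewrite mulr0 addr0.
apply: cvg_eq_near; near=> e.
have e0 : e != 0 by near: e; exact: near_right_neq0.
by rewrite /= divfK ?expf_neq0// addrC subrK.
Unshelve. all: by end_near. Qed.

Lemma jetM f g a0 a1 a2 b0 b1 b2 : jet f a0 a1 a2 -> jet g b0 b1 b2 ->
  jet (fun e => f e * g e) (a0 * b0) (a0 * b1 + a1 * b0)
    (a0 * b2 + a1 * b1 + a2 * b0).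
Proof.
move=> jf jg; have gb := jet_cvg jg.
(* With [P], [Q] the two quadratics, [f g - P Q = (f - P) g + P (g - Q)]; [h3] accounts for the
   terms of degree 3 and 4 of [P Q], which the product jet drops. *)
have h1 := cvgM_right jf gb.
have h2 := cvgM_right (cvg_poly2 a0 a1 a2) jg.
have h3 := cvgM_right cvg_id0 (cvg_poly2 (a1 * b2 + a2 * b1) (a2 * b2) 0).
have := cvgD_right (cvgD_right h1 h2) h3; rewrite !(mul0r, mulr0, addr0).
apply: cvg_eq_near; near=> e.
have e0 : e != 0 by near: e; exact: near_right_neq0.
by rewrite /=; field.
Unshelve. all: by end_near. Qed.

Lemma jet_bound f a0 a1 a2 (K : R) :
  (\forall e \near 0^'+, `|f e - (a0 + a1 * e + a2 * e ^+ 2)| <= K * e ^+ 3) ->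
  jet f a0 a1 a2.
Proof.
move=> h; have hK := cvgM_right (cvg_cst_right K) cvg_id0.
have := cvgN_right hK; move: hK; rewrite mulr0 oppr0 => hK hN.
apply: (squeeze_cvgr _ hN hK); near=> e.
have e0 : 0 < e by near: e; exact: nbhs_right_gt.
rewrite /= -ler_norml normrM normfV (@ger0_norm _ (e ^+ 2)) ?exprn_ge0 ?(ltW e0)//.
rewrite ler_pdivrMr ?exprn_gt0// (_ : K * e * e ^+ 2 = K * e ^+ 3); last by ring.
by near: e.
Unshelve. all: by end_near. Qed.

(** Each of the four bounds on sine and cosine below comes from the preceding one by this
    inequality. Their constants are not sharp; only the power of [x] matters. *)
Lemma MVT_norm_le (f df : R -> R) (x B : R) :
  (forall t : R, is_derive t 1 f (df t)) ->
  (forall t, `|t| <= `|x| -> `|df t| <= B) -> `|f x - f 0| <= B * `|x|.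
Proof.
move=> fdf dfB.
have fc a b : {within `[a, b], continuous f}.
  apply: continuous_subspaceT => t; apply: differentiable_continuous.
  by apply/derivable1_diffP; exact: ex_derive.
have [x0|x0] := leP 0 x.
  have [t tx ->] := MVT_segment x0 (fun t _ => fdf t) (fc 0 x).
  rewrite subr0 normrM ler_wpM2r//; apply: dfB; move: tx; rewrite in_itv /=.
  by move=> /andP[t0 tx]; rewrite !ger0_norm.
have [t tx h] := MVT_segment (ltW x0) (fun t _ => fdf t) (fc x 0).
rewrite distrC h sub0r normrM normrN ler_wpM2r//; apply: dfB.
move: tx; rewrite in_itv /= => /andP[xt t0].
by rewrite !ler0_norm ?lerN2// ltW.
Qed.

Lemma sin_le_norm (x : R) : `|sin x| <= `|x|.
Proof.
have := @MVT_norm_le sin cos x 1; rewrite sin0 subr0 mul1r; apply=> t.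
by move=> _; exact: cos_max.
Qed.

Lemma cos_sub1_le (x : R) : `|cos x - 1| <= `|x| ^+ 2.
Proof.
rewrite -cos0 expr2; apply: (@MVT_norm_le cos (fun t => - sin t)) => t tx.
by rewrite normrN (le_trans (sin_le_norm t)).
Qed.

Lemma sin_sub_id_le (x : R) : `|sin x - x| <= `|x| ^+ 3.
Proof.
have := @MVT_norm_le (fun t => sin t - t) (fun t => cos t - 1) x (`|x| ^+ 2).
rewrite sin0 !subr0 -exprSr; apply=> t tx.
by apply: le_trans (cos_sub1_le _) _; rewrite lerXn2r ?nnegrE.
Qed.

Lemma cos_sub_quad_le (x : R) : `|cos x - 1 + x ^+ 2 / 2| <= `|x| ^+ 4.
Proof.
have := @MVT_norm_le (fun t => cos t - 1 + t ^+ 2 / 2) (fun t => - (sin t - t)) x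
  (`|x| ^+ 3).
rewrite cos0 subrr expr0n mul0r addr0 subr0 -exprSr; apply=> t.
  by apply: is_derive_eq; rewrite /GRing.scale /=; field.
by move=> tx; rewrite normrN (le_trans (sin_sub_id_le _))// lerXn2r ?nnegrE.
Unshelve. all: by [].
Qed.

Lemma jet_sin a : jet (fun e => sin (a * e)) 0 a 0.
Proof.
apply: (@jet_bound _ _ _ _ (`|a| ^+ 3)); near=> e.
have e0 : 0 < e by near: e; exact: nbhs_right_gt.
rewrite add0r mul0r addr0; apply: le_trans (sin_sub_id_le _) _.
by rewrite normrM (gtr0_norm e0) exprMn.
Unshelve. all: by end_near. Qed.

Lemma jet_cos a : jet (fun e => cos (a * e)) 1 0 (- (a ^+ 2 / 2)).
Proof.
apply: (@jet_bound _ _ _ _ (`|a| ^+ 4)); near=> e.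
have e0 : 0 < e by near: e; exact: nbhs_right_gt.
have -> : cos (a * e) - (1 + 0 * e + - (a ^+ 2 / 2) * e ^+ 2) =
  cos (a * e) - 1 + (a * e) ^+ 2 / 2 by field.
apply: le_trans (cos_sub_quad_le _) _.
rewrite normrM (gtr0_norm e0) exprMn ler_wpM2l ?exprn_ge0//.
rewrite [e ^+ 4]exprSr ger_pMr ?exprn_gt0//; near: e; exact: nbhs_right_le.
Unshelve. all: by end_near. Qed.

Definition small f := jet f 0 0 0.

Lemma smallE f : small f <-> f e / e ^+ 2 @[e --> 0^'+] --> 0.
Proof.
by rewrite /small /jet; under eq_fun do rewrite !mul0r !addr0 subr0.
Qed.

Lemma smallD f g : small f -> small g -> small (fun e => f e + g e).
Proof. by move=> sf sg; apply: jet_eq (jetD sf sg); rewrite addr0. Qed.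

Lemma smallM f g (l : R) : g e @[e --> 0^'+] --> l -> small f ->
  small (fun e => g e * f e).
Proof.
move=> gl /smallE sf; apply/smallE; have := cvgM_right gl sf; rewrite mulr0.
by apply: cvg_eq_near; near=> e; rewrite /= mulrA.
Unshelve. all: by end_near. Qed.

Lemma smallZ f a : small f -> small (fun e => a * f e).
Proof. by apply: smallM; exact: cvg_cst_right. Qed.

Lemma small_sum (I : Type) (r : seq I) (F : I -> R -> R) :
  (forall i, small (F i)) -> small (fun e => \sum_(i <- r) F i e).
Proof.
move=> sF; elim: r => [|i r IH].
  by under [X in small X]eq_fun do rewrite big_nil; exact: jet_cst.
under [X in small X]eq_fun do rewrite big_cons.
exact: smallD.
Qed.

Lemma small_littleo f : small f ->
  forall eta, 0 < eta -> \forall e \near 0^'+, `|f e| <= eta * `|e ^+ 2|.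
Proof.
move=> /smallE /cvgr0Pnorm_le sf eta eta0.
near=> e; have e0 : e != 0 by near: e; exact: near_right_neq0.
have : `|f e / e ^+ 2| <= eta by near: e; exact: sf.
by rewrite normrM normfV ler_pdivrMr// normr_gt0 expf_neq0.
Unshelve. all: by end_near. Qed.

Lemma jet_of_small f g (c0 c1 c2 : R) : jet g c0 c1 c2 ->
  small (fun e => f e - g e) -> jet f c0 c1 c2.
Proof.
move=> jg sfg; have -> : f = (fun e => (f e - g e) + g e).
  by apply/funext => e; rewrite subrK.
by apply: jet_eq (jetD sfg jg); rewrite add0r.
Qed.

Lemma small_eqN (f g : R -> R) : small f -> (forall e, g e = - f e) -> small g.
Proof.
move=> sf gf; have -> : g = (fun e => - f e) by apply/funext.
by apply: jet_eq (jetN sf); rewrite oppr0.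
Qed.

Lemma small_eq (f g : R -> R) : small f -> (forall e, g e = f e) -> small g.
Proof. by move=> sf gf; have -> : g = f by apply/funext. Qed.

Lemma scalar_littleo (f g : R -> R) (c0 c1 c2 : R) : jet f c0 c1 c2 ->
  (forall e, g e = c0 + c1 * e + c2 * e ^+ 2) ->
  f = g +o_ (0^'+) (fun e : R => e ^+ 2).
Proof.
move=> jf gE; apply/eqaddoP => eta eta0.
have sfg : small (fun e => f e - g e).
  have -> : g = (fun e => c0 + c1 * e + c2 * e ^+ 2) by apply/funext.
  by apply: jet_eq (jetD jf (jetN (jet_poly c0 c1 c2))); rewrite subrr.
exact: small_littleo.
Qed.

End Jets.

(** Computes the jet of an arithmetic expression from the hypotheses on its atoms and instantiates
    the coefficients. After [jet_eq], three scalar identities remain, one per order. *)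
Ltac jets := lazymatch goal with
  | |- jet (fun _ => ?c) _ _ _ => exact: jet_cst
  | |- jet (fun e => @?f e + @?g e) _ _ _ => apply: (@jetD _ f g); jets
  | |- jet (fun e => - @?f e) _ _ _ => apply: (@jetN _ f); jets
  | |- jet (fun e => @?f e * @?g e) _ _ _ => apply: (@jetM _ f g); jets
  | |- jet (fun e => ?f e) _ _ _ =>
      match goal with H : jet f _ _ _ |- _ => exact H end
  end.

(** * Force and torque balance *)

Section Scallops.
Context {R : realType}.
Variables (L Cpar Cperp lam : R).
Hypotheses (hL : 0 < L) (hCpar : 0 < Cpar) (hCperp : 0 < Cperp) (hlam : 0 < lam < 1).
Hypothesis hinv : forall th1 th2 sg1 sg2 : R,
  resistance L Cpar Cperp lam th1 th2 sg1 sg2 \in unitmx.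

(* Components, divided by [L], of the drag force on one scallop moving with
   velocity [(x, y, t, u)]; [(c1, s1)] and [(c2, s2)] are the directions of its
   two links. *)
Definition forceX (c1 s1 c2 s2 x y t u : R) : R :=
  2 * Cperp * x
  + (Cpar - Cperp) * ((c1 * x + s1 * y) * c1 + (c2 * x + s2 * y) * c2)
  - L / 2 * Cperp * ((s1 + s2) * t + s2 * u).

Definition forceY (c1 s1 c2 s2 x y t u : R) : R :=
  2 * Cperp * y
  + (Cpar - Cperp) * ((c1 * x + s1 * y) * s1 + (c2 * x + s2 * y) * s2)
  + L / 2 * Cperp * ((c1 + c2) * t + c2 * u).

(* Primed arguments belong to the other scallop. *)
Definition torque (c1 s1 c2 s2 c1' s1' c2' s2' x y t u x' y' t' u' : R) : R :=
  L ^+ 2 / 2 * Cperp * ((c1 + c2) * y - (s1 + s2) * x)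
  + 2 * L ^+ 3 * Cperp / 3 * (t + u / 2)
  - lam * (L ^+ 2 * (Cpar - Cperp) / 2 *
             ((c1 * s1' - s1 * c1') * (c1' * x' + s1' * y')
              + (c2 * s2' - s2 * c2') * (c2' * x' + s2' * y'))
           + L ^+ 2 / 2 * Cperp * ((c1 + c2) * y' - (s1 + s2) * x')
           + L ^+ 3 * Cperp / 3 *
             ((c1 * c1' + s1 * s1' + c2 * c2' + s2 * s2') * t'
              + (c2 * c2' + s2 * s2') * u')).

Definition mkvel (x1 y1 t1 x2 y2 t2 : R) : 'cV[R]_6 :=
  col_mx (col_mx (vec2 x1 y1) t1%:M) (col_mx (vec2 x2 y2) t2%:M).

(** The position rows of one scallop contain [A] and [b] of the other with the factor [- lam], so
    they combine two single-scallop forces. The torque rows contain [d] instead and do not separate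
    in this way. *)
Lemma resistance_mkvel th1 th2 sg1 sg2 x1 y1 t1 x2 y2 t2 u1 u2 :
  let fX1 := forceX (cos th1) (sin th1) (cos (th1 + sg1)) (sin (th1 + sg1))
               x1 y1 t1 u1 in
  let fY1 := forceY (cos th1) (sin th1) (cos (th1 + sg1)) (sin (th1 + sg1))
               x1 y1 t1 u1 in
  let fX2 := forceX (cos th2) (sin th2) (cos (th2 + sg2)) (sin (th2 + sg2))
               x2 y2 t2 u2 in
  let fY2 := forceY (cos th2) (sin th2) (cos (th2 + sg2)) (sin (th2 + sg2))
               x2 y2 t2 u2 in
  resistance L Cpar Cperp lam th1 th2 sg1 sg2 *m mkvel x1 y1 t1 x2 y2 t2
    + (u1 *: phi1 L Cperp lam th1 th2 sg1 sg2
       + u2 *: phi2 L Cperp lam th1 th2 sg1 sg2) =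
  mkvel (L * (fX1 - lam * fX2)) (L * (fY1 - lam * fY2))
    (torque (cos th1) (sin th1) (cos (th1 + sg1)) (sin (th1 + sg1))
            (cos th2) (sin th2) (cos (th2 + sg2)) (sin (th2 + sg2))
            x1 y1 t1 u1 x2 y2 t2 u2)
    (L * (fX2 - lam * fX1)) (L * (fY2 - lam * fY1))
    (torque (cos th2) (sin th2) (cos (th2 + sg2)) (sin (th2 + sg2))
            (cos th1) (sin th1) (cos (th1 + sg1)) (sin (th1 + sg1))
            x2 y2 t2 u2 x1 y1 t1 u1).
Proof.
have e1 th sg : e th sg 1 = vec2 (cos th) (sin th).
  by rewrite /e /= mul0r addr0.
have e2 th sg : e th sg 2 = vec2 (cos (th + sg)) (sin (th + sg)).
  by rewrite /e /= mul1r.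
have dotE a1 a2 b1 b2 : dot (vec2 a1 a2) (vec2 b1 b2) = a1 * b1 + a2 * b2 :> R.
  by rewrite /dot !mxE 2!big_ord_recl big_ord0 !mxE /= addr0.
have perpE a1 a2 : perp (vec2 a1 a2) = vec2 (- a2) a1 :> 'cV[R]_2.
  by rewrite /perp !mxE.
have vecD a1 a2 b1 b2 : vec2 a1 a2 + vec2 b1 b2 = vec2 (a1 + b1) (a2 + b2) :> 'cV[R]_2.
  by apply/matrixP => i j; rewrite !mxE; case: i => [[|[|]]].
have vecZ k a1 a2 : k *: vec2 a1 a2 = vec2 (k * a1) (k * a2) :> 'cV[R]_2.
  by apply/matrixP => i j; rewrite !mxE; case: i => [[|[|]]].
have bE th sg : b L Cperp th sg = vec2
    (L ^+ 2 / 2 * Cperp * - (sin th + sin (th + sg)))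
    (L ^+ 2 / 2 * Cperp * (cos th + cos (th + sg))).
  by rewrite /b e1 e2 vecD perpE vecZ.
have alphaE th sg : alpha L Cperp th sg = vec2
    (L ^+ 2 / 2 * Cperp * - sin (th + sg)) (L ^+ 2 / 2 * Cperp * cos (th + sg)).
  by rewrite /alpha e2 perpE vecZ.
have AE th sg x y : A L Cpar Cperp th sg *m vec2 x y = vec2
   (L * (2 * Cperp * x + (Cpar - Cperp) * ((cos th * x + sin th * y) * cos th
      + (cos (th + sg) * x + sin (th + sg) * y) * cos (th + sg))))
   (L * (2 * Cperp * y + (Cpar - Cperp) * ((cos th * x + sin th * y) * sin th
      + (cos (th + sg) * x + sin (th + sg) * y) * sin (th + sg)))).
  rewrite /A /E e1 e2.
  apply/matrixP => i j; rewrite (ord1 j) !mxE 2!big_ord_recl big_ord0 !mxE !big_ord1 !mxE.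
  by case: i => [[|[|]]] //= _; rewrite /bump /=; ring.
have trE a1 a2 x y : (vec2 a1 a2)^T *m vec2 x y = (a1 * x + a2 * y)%:M :> 'M[R]_1.
  apply/matrixP => i j; rewrite (ord1 i) (ord1 j) !mxE 2!big_ord_recl big_ord0 !mxE /=.
  by rewrite mulr1n addr0.
have scE a1 a2 t : vec2 a1 a2 *m t%:M = vec2 (a1 * t) (a2 * t) :> 'cV[R]_2.
  by rewrite mul_mx_scalar vecZ; congr vec2; rewrite mulrC.
rewrite /= /resistance /mkvel /phi1 /phi2.
rewrite (@mul_block_col _ 3 3 3 3 1) !(@mul_block_col _ 2 1 2 1 1).
rewrite !(@scale_col_mx _ 3 3 1) !(@scale_col_mx _ 2 1 1).
rewrite !(@add_col_mx _ 3 3 1) !(@add_col_mx _ 2 1 1).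
rewrite -!(@scalemxAl _ _ _ _ (- lam)).
rewrite !AE.
rewrite /d !e1 !e2 !perpE !dotE !bE !alphaE !vecZ !vecD !trE !scE -!scalar_mxM.
rewrite /beta /varpi /omega !e1 !e2 !dotE.
rewrite !vecZ !vecD !trE !scale_scalar_mx -!(raddfD (@scalar_mx R 1)).
by apply: (congr2 (@col_mx _ 3 3 1)); apply: (congr2 (@col_mx _ 2 1 1));
  [apply: (congr2 vec2)|apply: (congr1 (@scalar_mx R 1))
  |apply: (congr2 vec2)|apply: (congr1 (@scalar_mx R 1))];
  rewrite /= /forceX /forceY /torque; field.
Qed.

(** The combination [u1 v1 + u2 v2] of the control fields; keeping the controls as parameters lets
    one statement serve for both fields. *)
Definition field (u1 u2 : R) (z : 'cV[R]_8) : 'cV[R]_8 :=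
  col_mx
    (- (invmx (resistance L Cpar Cperp lam
                 (theta1 z) (theta2 z) (sigma1 z) (sigma2 z))
        *m (u1 *: phi1 L Cperp lam (theta1 z) (theta2 z) (sigma1 z) (sigma2 z)
            + u2 *: phi2 L Cperp lam (theta1 z) (theta2 z) (sigma1 z) (sigma2 z))))
    (vec2 u1 u2).

Lemma v1_field : v1 L Cpar Cperp lam = field 1 0.
Proof. by apply/funext => z; rewrite /field scale1r scale0r addr0. Qed.

Lemma v2_field : v2 L Cpar Cperp lam = field 0 1.
Proof. by apply/funext => z; rewrite /field scale1r scale0r add0r. Qed.

(** * Differentiability of the control fields *)

Section Entries.
Context {V : normedModType R}.
Variables (th1 th2 sg1 sg2 : V -> R) (x : V).
Hypotheses (dth1 : differentiable th1 x) (dth2 : differentiable th2 x)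
  (dsg1 : differentiable sg1 x) (dsg2 : differentiable sg2 x).

Lemma mxdiff_resistance : mxdiff x (fun y =>
  resistance L Cpar Cperp lam (th1 y) (th2 y) (sg1 y) (sg2 y)).
Proof.
have de (th sg : V -> R) j : differentiable th x -> differentiable sg x ->
   mxdiff x (fun y => e (th y) (sg y) j) by exact: mxdiff_e.
have dA (th sg : V -> R) : differentiable th x -> differentiable sg x ->
   mxdiff x (fun y => A L Cpar Cperp (th y) (sg y)).
  move=> dth dsg; apply: mxdiffZc; apply: mxdiffD; first exact: mxdiff_cst.
  by apply: mxdiffZc; apply: mxdiffD; apply: mxdiffM; try apply: mxdiff_tr; exact: de.
have db (th sg : V -> R) : differentiable th x -> differentiable sg x ->
   mxdiff x (fun y => b L Cperp (th y) (sg y)).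
  by move=> dth dsg; apply: mxdiffZc; apply: mxdiff_perp; apply: mxdiffD; exact: de.
have dd (th sg th' sg' : V -> R) : differentiable th x -> differentiable sg x ->
   differentiable th' x -> differentiable sg' x ->
   mxdiff x (fun y => d L Cpar Cperp (th y) (sg y) (th' y) (sg' y)).
  move=> dth dsg dth' dsg'; apply: mxdiffD; last exact: db.
  apply: mxdiffZc; apply: mxdiffD; apply: mxdiffZ; try exact: de;
    apply: differentiable_dot; try exact: de; apply: mxdiff_perp; exact: de.
have dv : differentiable (fun y => varpi L Cperp (th1 y) (th2 y) (sg1 y) (sg2 y)) x.
  apply: differentiableM; first exact: differentiable_cst.
  by apply: differentiableD; apply: differentiable_dot; exact: de.
have dvp : mxdiff x (fun y =>
    (varpi L Cperp (th1 y) (th2 y) (sg1 y) (sg2 y))%:M : 'M[R]_1).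
  exact: mxdiff_scalar.
apply: (@mxdiff_block _ _ _ 3 3 3 3); apply: (@mxdiff_block _ _ _ 2 1 2 1);
  first [exact: dA|exact: db|exact: mxdiff_cst|apply: mxdiff_tr; exact: db
    |apply: mxdiffZc; first [exact: dA|exact: db|exact: dvp|apply: mxdiff_tr; exact: dd]].
Qed.

Lemma mxdiff_field_rhs (u1 u2 : R) : mxdiff x (fun y =>
  u1 *: phi1 L Cperp lam (th1 y) (th2 y) (sg1 y) (sg2 y)
  + u2 *: phi2 L Cperp lam (th1 y) (th2 y) (sg1 y) (sg2 y)).
Proof.
have de (th sg : V -> R) j : differentiable th x -> differentiable sg x ->
   mxdiff x (fun y => e (th y) (sg y) j) by exact: mxdiff_e.
have da (th sg : V -> R) : differentiable th x -> differentiable sg x ->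
   mxdiff x (fun y => alpha L Cperp (th y) (sg y)).
  by move=> dth dsg; apply: mxdiffZc; apply: mxdiff_perp; exact: de.
have dbeta : differentiable (fun y =>
    - lam * beta L Cperp (th1 y) (th2 y) (sg1 y) (sg2 y)) x.
  apply: differentiableM; first exact: differentiable_cst.
  apply: differentiableM; first exact: differentiable_cst.
  by apply: differentiable_dot; exact: de.
apply: mxdiffD; apply: mxdiffZc; apply: (@mxdiff_col _ _ _ 3 3);
  apply: (@mxdiff_col _ _ _ 2 1);
  first [exact: da|exact: mxdiff_scalar|exact: mxdiff_cst|apply: mxdiffZc; exact: da].
Qed.

End Entries.

Lemma differentiable_field (u1 u2 : R) (z : 'cV[R]_8) :
  differentiable (field u1 u2) z.
Proof.
apply: mxdiff_differentiable; apply: (@mxdiff_col _ _ _ 6 2); last exact: mxdiff_cst.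
have dt1 : differentiable (@theta1 R) z by exact: differentiable_coord.
have dt2 : differentiable (@theta2 R) z by exact: differentiable_coord.
have ds1 : differentiable (@sigma1 R) z by exact: differentiable_coord.
have ds2 : differentiable (@sigma2 R) z by exact: differentiable_coord.
apply: mxdiffN; apply: mxdiffM; last exact: mxdiff_field_rhs.
by apply: mxdiff_inv => //; exact: mxdiff_resistance.
Qed.

Lemma mkvelE (x1 y1 t1 x2 y2 t2 : R) (i : 'I_6) :
  mkvel x1 y1 t1 x2 y2 t2 i 0 = nth 0 [:: x1; y1; t1; x2; y2; t2] i.
Proof.
rewrite /mkvel (@mxE _ 6 1); case: (@splitP 3 3 i) => k ->;
  rewrite (@mxE _ 3 1); case: (@splitP 2 1 k) => l ->; rewrite mxE.
- by case: l => [[|[|]]].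
- by rewrite (ord1 l).
- by case: l => [[|[|]]].
- by rewrite (ord1 l).
Qed.

Lemma mkvel_eta (w : 'cV[R]_6) :
  w = mkvel (w (inord 0) 0) (w (inord 1) 0) (w (inord 2) 0)
            (w (inord 3) 0) (w (inord 4) 0) (w (inord 5) 0).
Proof.
apply/matrixP => i j; rewrite (ord1 j) mkvelE -[in LHS](inord_val i).
by case: i => [[|[|[|[|[|[|]]]]]]].
Qed.

Lemma field_col (w : 'cV[R]_6) (v : 'cV[R]_2) (k : nat) : (k < 6)%N ->
  (col_mx w v : 'cV[R]_8) (inord k) 0 = w (inord k) 0.
Proof.
move=> k6; have -> : (inord k : 'I_8) = @lshift 6 2 (inord k).
  by apply/val_inj; rewrite /= !inordK// (ltn_trans k6).
exact: col_mxEu.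
Qed.

Lemma field_u1 (w : 'cV[R]_6) (u1 u2 : R) :
  (col_mx w (vec2 u1 u2) : 'cV[R]_8) (inord 6) 0 = u1.
Proof.
have -> : (inord 6 : 'I_8) = @rshift 6 2 0 by apply/val_inj; rewrite /= inordK.
by rewrite (@col_mxEd _ 6 2) mxE.
Qed.

Lemma field_u2 (w : 'cV[R]_6) (u1 u2 : R) :
  (col_mx w (vec2 u1 u2) : 'cV[R]_8) (inord 7) 0 = u2.
Proof.
have -> : (inord 7 : 'I_8) = @rshift 6 2 1 by apply/val_inj; rewrite /= inordK.
by rewrite (@col_mxEd _ 6 2) mxE.
Qed.

Definition balanced (c1 s1 c2 s2 c1' s1' c2' s2' x y t u x' y' t' u' : R) :=
  [/\ forceX c1 s1 c2 s2 x y t u = 0,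
      forceY c1 s1 c2 s2 x y t u = 0 &
      torque c1 s1 c2 s2 c1' s1' c2' s2' x y t u x' y' t' u' = 0].

Lemma lam2_neq0 : 1 - lam ^+ 2 != 0.
Proof.
have -> : 1 - lam ^+ 2 = (1 - lam) * (1 + lam) by ring.
case/andP: hlam => l0 l1; rewrite mulf_neq0//; apply: lt0r_neq0; lra.
Qed.

(* The position rows of the system couple the scallops only through the
   invertible matrix [[1, -lam], [-lam, 1]], hence decouple. *)
Lemma field_balanced (u1 u2 : R) (z : 'cV[R]_8) (F := field u1 u2 z)
    (th1 := theta1 z) (th2 := theta2 z) (sg1 := sigma1 z) (sg2 := sigma2 z) :
  balanced (cos th1) (sin th1) (cos (th1 + sg1)) (sin (th1 + sg1))
           (cos th2) (sin th2) (cos (th2 + sg2)) (sin (th2 + sg2))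
    (F (inord 0) 0) (F (inord 1) 0) (F (inord 2) 0) u1
    (F (inord 3) 0) (F (inord 4) 0) (F (inord 5) 0) u2 /\
  balanced (cos th2) (sin th2) (cos (th2 + sg2)) (sin (th2 + sg2))
           (cos th1) (sin th1) (cos (th1 + sg1)) (sin (th1 + sg1))
    (F (inord 3) 0) (F (inord 4) 0) (F (inord 5) 0) u2
    (F (inord 0) 0) (F (inord 1) 0) (F (inord 2) 0) u1.
Proof.
rewrite /F /field !field_col//; set w := - _.
have : resistance L Cpar Cperp lam th1 th2 sg1 sg2 *m w
    + (u1 *: phi1 L Cperp lam th1 th2 sg1 sg2
       + u2 *: phi2 L Cperp lam th1 th2 sg1 sg2) = 0.
  by rewrite /w mulmxN mulKVmx// addNr.
rewrite [w in _ *m w]mkvel_eta resistance_mkvel => /matrixP E.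
move: (E 0 0) (E 1 0) (E 2 0) (E 3 0) (E 4 0) (E 5 0).
rewrite !mkvelE !mxE /= => E0 E1 E2 E3 E4 E5.
have dec a1 a2 : L * (a1 - lam * a2) = 0 -> L * (a2 - lam * a1) = 0 -> a1 = 0.
  move=> /eqP; rewrite mulf_eq0 (gt_eqF hL)/= => /eqP h1.
  move=> /eqP; rewrite mulf_eq0 (gt_eqF hL)/= => /eqP h2.
  have : (1 - lam ^+ 2) * a1 = 0.
    by rewrite (_ : _ * a1 = (a1 - lam * a2) + lam * (a2 - lam * a1)); [rewrite h1 h2; ring|ring].
  by move/eqP; rewrite mulf_eq0 (negbTE lam2_neq0)/= => /eqP.
by split; split=> //; [exact: dec E0 E3|exact: dec E1 E4|exact: dec E3 E0|exact: dec E4 E1].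
Qed.

(* Derivatives in the link directions only: the forces being linear in the
   velocity, the derivative in the velocity is the force itself, with [u = 0]. *)
Definition dforceX (c1 s1 c2 s2 dc1 ds1 dc2 ds2 x y t u : R) : R :=
  (Cpar - Cperp) * ((dc1 * x + ds1 * y) * c1 + (c1 * x + s1 * y) * dc1
                    + ((dc2 * x + ds2 * y) * c2 + (c2 * x + s2 * y) * dc2))
  - L / 2 * Cperp * ((ds1 + ds2) * t + ds2 * u).

Definition dforceY (c1 s1 c2 s2 dc1 ds1 dc2 ds2 x y t u : R) : R :=
  (Cpar - Cperp) * ((dc1 * x + ds1 * y) * s1 + (c1 * x + s1 * y) * ds1
                    + ((dc2 * x + ds2 * y) * s2 + (c2 * x + s2 * y) * ds2))
  + L / 2 * Cperp * ((dc1 + dc2) * t + dc2 * u).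

Definition dtorque (c1 s1 c2 s2 dc1 ds1 dc2 ds2
    c1' s1' c2' s2' dc1' ds1' dc2' ds2' x y x' y' t' u' : R) : R :=
  L ^+ 2 / 2 * Cperp * ((dc1 + dc2) * y - (ds1 + ds2) * x)
  - lam * (L ^+ 2 * (Cpar - Cperp) / 2 *
             ((dc1 * s1' + c1 * ds1' - (ds1 * c1' + s1 * dc1')) * (c1' * x' + s1' * y')
              + (c1 * s1' - s1 * c1') * (dc1' * x' + ds1' * y')
              + ((dc2 * s2' + c2 * ds2' - (ds2 * c2' + s2 * dc2')) * (c2' * x' + s2' * y')
              + (c2 * s2' - s2 * c2') * (dc2' * x' + ds2' * y')))
           + L ^+ 2 / 2 * Cperp * ((dc1 + dc2) * y' - (ds1 + ds2) * x')
           + L ^+ 3 * Cperp / 3 *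
             ((dc1 * c1' + c1 * dc1' + (ds1 * s1' + s1 * ds1')
               + (dc2 * c2' + c2 * dc2' + (ds2 * s2' + s2 * ds2'))) * t'
              + (dc2 * c2' + c2 * dc2' + (ds2 * s2' + s2 * ds2')) * u')).

Section Curve.
Variables (c1 s1 c2 s2 x y t c1' s1' c2' s2' x' y' t' : R -> R).
Variables (dc1 ds1 dc2 ds2 dx dy dt dc1' ds1' dc2' ds2' dx' dy' dt' u u' r : R).
Hypotheses (hc1 : is_derive r 1 c1 dc1) (hs1 : is_derive r 1 s1 ds1)
  (hc2 : is_derive r 1 c2 dc2) (hs2 : is_derive r 1 s2 ds2)
  (hx : is_derive r 1 x dx) (hy : is_derive r 1 y dy) (ht : is_derive r 1 t dt)
  (hc1' : is_derive r 1 c1' dc1') (hs1' : is_derive r 1 s1' ds1')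
  (hc2' : is_derive r 1 c2' dc2') (hs2' : is_derive r 1 s2' ds2')
  (hx' : is_derive r 1 x' dx') (hy' : is_derive r 1 y' dy')
  (ht' : is_derive r 1 t' dt').

Lemma is_derive_forceX : is_derive r 1
  (fun r => forceX (c1 r) (s1 r) (c2 r) (s2 r) (x r) (y r) (t r) u)
  (forceX (c1 r) (s1 r) (c2 r) (s2 r) dx dy dt 0
   + dforceX (c1 r) (s1 r) (c2 r) (s2 r) dc1 ds1 dc2 ds2 (x r) (y r) (t r) u).
Proof.
rewrite /forceX; apply: is_derive_eq; rewrite /dforceX /GRing.scale /=; field.
Unshelve. all: by [].
Qed.

Lemma is_derive_forceY : is_derive r 1
  (fun r => forceY (c1 r) (s1 r) (c2 r) (s2 r) (x r) (y r) (t r) u)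
  (forceY (c1 r) (s1 r) (c2 r) (s2 r) dx dy dt 0
   + dforceY (c1 r) (s1 r) (c2 r) (s2 r) dc1 ds1 dc2 ds2 (x r) (y r) (t r) u).
Proof.
rewrite /forceY; apply: is_derive_eq; rewrite /dforceY /GRing.scale /=; field.
Unshelve. all: by [].
Qed.

Lemma is_derive_torque : is_derive r 1
  (fun r => torque (c1 r) (s1 r) (c2 r) (s2 r) (c1' r) (s1' r) (c2' r) (s2' r)
     (x r) (y r) (t r) u (x' r) (y' r) (t' r) u')
  (torque (c1 r) (s1 r) (c2 r) (s2 r) (c1' r) (s1' r) (c2' r) (s2' r)
     dx dy dt 0 dx' dy' dt' 0
   + dtorque (c1 r) (s1 r) (c2 r) (s2 r) dc1 ds1 dc2 ds2
       (c1' r) (s1' r) (c2' r) (s2' r) dc1' ds1' dc2' ds2'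
       (x r) (y r) (x' r) (y' r) (t' r) u').
Proof.
rewrite /torque; apply: is_derive_eq; rewrite /dtorque /GRing.scale /=; field.
Unshelve. all: by [].
Qed.

End Curve.

(* [k], [l] are the angular velocities of the two links of the scallop. *)
Definition dbalanced (c1 s1 c2 s2 k l c1' s1' c2' s2' k' l'
    x y t u x' y' t' u' dx dy dt dx' dy' dt' : R) :=
  [/\ forceX c1 s1 c2 s2 dx dy dt 0
      + dforceX c1 s1 c2 s2 (- s1 * k) (c1 * k) (- s2 * l) (c2 * l)
          x y t u = 0,
      forceY c1 s1 c2 s2 dx dy dt 0
      + dforceY c1 s1 c2 s2 (- s1 * k) (c1 * k) (- s2 * l) (c2 * l)
          x y t u = 0 &
      torque c1 s1 c2 s2 c1' s1' c2' s2' dx dy dt 0 dx' dy' dt' 0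
      + dtorque c1 s1 c2 s2 (- s1 * k) (c1 * k) (- s2 * l) (c2 * l)
          c1' s1' c2' s2' (- s1' * k') (c1' * k') (- s2' * l') (c2' * l')
          x y x' y' t' u' = 0].

(** The balance holds for every [r], so its left sides are constant and their derivatives at 0
    vanish. Along a straight line of states the link angles are affine in [r], with rates [k],
    [l]. *)
Lemma dbalanced_curve (a b a' b' k l k' l' u u' dx dy dt dx' dy' dt' : R)
    (x y t x' y' t' : R -> R) :
  is_derive (0 : R) 1 x dx -> is_derive (0 : R) 1 y dy -> is_derive (0 : R) 1 t dt ->
  is_derive (0 : R) 1 x' dx' -> is_derive (0 : R) 1 y' dy' ->
  is_derive (0 : R) 1 t' dt' ->
  (forall r, balanced
     (cos (a + r * k)) (sin (a + r * k)) (cos (b + r * l)) (sin (b + r * l))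
     (cos (a' + r * k')) (sin (a' + r * k')) (cos (b' + r * l')) (sin (b' + r * l'))
     (x r) (y r) (t r) u (x' r) (y' r) (t' r) u') ->
  dbalanced (cos a) (sin a) (cos b) (sin b) k l (cos a') (sin a') (cos b') (sin b')
    k' l' (x 0) (y 0) (t 0) u (x' 0) (y' 0) (t' 0) u' dx dy dt dx' dy' dt'.
Proof.
move=> hx hy ht hx' hy' ht' bal.
have c1 := is_derive_cos_affine a k 0; have s1 := is_derive_sin_affine a k 0.
have c2 := is_derive_cos_affine b l 0; have s2 := is_derive_sin_affine b l 0.
have c1' := is_derive_cos_affine a' k' 0; have s1' := is_derive_sin_affine a' k' 0.
have c2' := is_derive_cos_affine b' l' 0; have s2' := is_derive_sin_affine b' l' 0.
have zero (f : R -> R) df : is_derive (0 : R) 1 f df -> (forall r, f r = 0) -> df = 0.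
  move=> fdf f0; rewrite -(@derive_val _ _ _ _ _ _ _ fdf).
  by rewrite (_ : f = cst 0) ?derive_cst//; apply/funext.
split.
- have := zero _ _ (is_derive_forceX u c1 s1 c2 s2 hx hy ht).
  by rewrite !mul0r !addr0 => -> // r; have [] := bal r.
- have := zero _ _ (is_derive_forceY u c1 s1 c2 s2 hx hy ht).
  by rewrite !mul0r !addr0 => -> // r; have [] := bal r.
- have := zero _ _ (is_derive_torque u u' c1 s1 c2 s2 hx hy ht
    c1' s1' c2' s2' hx' hy' ht').
  by rewrite !mul0r !addr0 => -> // r; have [] := bal r.
Qed.

(** The curve is the line [z + r *: H]. The opening angles move at the rates [a1], [a2], the last
    components of [H], so the second links turn at the rates [k1 + a1] and [k2 + a2]. *)
Lemma field_dbalanced (a1 a2 b1 b2 : R) (z : 'cV[R]_8)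
    (H := field a1 a2 z) (F := field b1 b2 z) (D := 'd (field b1 b2) z H)
    (th1 := theta1 z) (th2 := theta2 z) (sg1 := sigma1 z) (sg2 := sigma2 z)
    (k1 := H (inord 2) 0) (k2 := H (inord 5) 0) :
  dbalanced (cos th1) (sin th1) (cos (th1 + sg1)) (sin (th1 + sg1)) k1 (k1 + a1)
            (cos th2) (sin th2) (cos (th2 + sg2)) (sin (th2 + sg2)) k2 (k2 + a2)
    (F (inord 0) 0) (F (inord 1) 0) (F (inord 2) 0) b1
    (F (inord 3) 0) (F (inord 4) 0) (F (inord 5) 0) b2
    (D (inord 0) 0) (D (inord 1) 0) (D (inord 2) 0)
    (D (inord 3) 0) (D (inord 4) 0) (D (inord 5) 0) /\
  dbalanced (cos th2) (sin th2) (cos (th2 + sg2)) (sin (th2 + sg2)) k2 (k2 + a2)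
            (cos th1) (sin th1) (cos (th1 + sg1)) (sin (th1 + sg1)) k1 (k1 + a1)
    (F (inord 3) 0) (F (inord 4) 0) (F (inord 5) 0) b2
    (F (inord 0) 0) (F (inord 1) 0) (F (inord 2) 0) b1
    (D (inord 3) 0) (D (inord 4) 0) (D (inord 5) 0)
    (D (inord 0) 0) (D (inord 1) 0) (D (inord 2) 0).
Proof.
have dF : differentiable (field b1 b2) z by exact: differentiable_field.
have der i : is_derive (0 : R) 1 (fun r => field b1 b2 (z + r *: H) i 0 : R) (D i 0).
  exact: is_derive_along.
pose G (i : 'I_8) (r : R) : R := field b1 b2 (z + r *: H) i 0.
have FG i : F i 0 = G i 0 by rewrite /F /G scale0r addr0.
rewrite !FG.
have shiftE (r : R) i : (z + r *: H) i 0 = z i 0 + r * H i 0 by rewrite 2!mxE.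
have H6 : H (inord 6) 0 = a1 by exact: field_u1.
have H7 : H (inord 7) 0 = a2 by exact: field_u2.
have E1 r : theta1 (z + r *: H) = th1 + r * k1 by exact: shiftE.
have E2 r : theta2 (z + r *: H) = th2 + r * k2 by exact: shiftE.
have E3 r : theta1 (z + r *: H) + sigma1 (z + r *: H) = th1 + sg1 + r * (k1 + a1).
  by rewrite E1 /sigma1 shiftE H6 -/(sigma1 z) -/sg1; ring.
have E4 r : theta2 (z + r *: H) + sigma2 (z + r *: H) = th2 + sg2 + r * (k2 + a2).
  by rewrite E2 /sigma2 shiftE H7 -/(sigma2 z) -/sg2; ring.
have bal r := field_balanced b1 b2 (z + r *: H).
by split; apply: dbalanced_curve; try exact: der; move=> r;
  have [] := bal r; rewrite E3 E4 E1 E2.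
Qed.

(* When the scallop of opening [pi + a * e] is actuated at unit rate,
   [kappa a b * e ^+ 2] is, up to the factor [lam * omega], the leading driving
   term in the torque balance of the other one, of opening [pi + b * e]. *)
Definition kappa (a b : R) : R :=
  - (3 / (2 * Cperp)) * (a - b) *
  (((Cpar - Cperp) * a + Cperp * b) / 16 + Cperp * (a - b) / 12).

(* [p] is the second-order coefficient of the mean angular velocity [t + u / 2]
   of the two links, which vanishes at orders 0 and 1. *)
Section FirstOrder.
Variables (a b u u' p p' : R) (C S C' S' x y t x' y' t' : R -> R).
Hypotheses (jC : jet C (-1) 0 (a ^+ 2 / 2)) (jS : jet S 0 (- a) 0)
  (jC' : jet C' (-1) 0 (b ^+ 2 / 2)) (jS' : jet S' 0 (- b) 0)
  (jx : jet x 0 (- (L / 8) * u * a) 0)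
  (jy : jet y (L * u / 4) 0 (- (L * u / 4) * (Cpar * a ^+ 2 / (4 * Cperp))))
  (jt : jet t (- (u / 2)) 0 p)
  (jx' : jet x' 0 (- (L / 8) * u' * b) 0)
  (jy' : jet y' (L * u' / 4) 0 (- (L * u' / 4) * (Cpar * b ^+ 2 / (4 * Cperp))))
  (jt' : jet t' (- (u' / 2)) 0 p').

Lemma small_forceX : small (fun e => forceX 1 0 (C e) (S e) (x e) (y e) (t e) u).
Proof.
have C0 := lt0r_neq0 hCperp.
by apply: jet_eq; last (rewrite /forceX; jets); field.
Qed.

Lemma small_forceY : small (fun e => forceY 1 0 (C e) (S e) (x e) (y e) (t e) u).
Proof.
have C0 := lt0r_neq0 hCperp.
by apply: jet_eq; last (rewrite /forceY; jets); field.
Qed.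

(** The assumption is the order-two part of the balance. The scallop's own hinge motion exerts no
    torque at this order: its transversal part [a ^+ 2 / 2 * (L * u / 4)] cancels its longitudinal
    part [a * (L * u * a / 8)], leaving only the action of the other scallop. *)
Lemma small_torque : p = lam * (p' + kappa b a * u') ->
  small (fun e => torque 1 0 (C e) (S e) 1 0 (C' e) (S' e)
    (x e) (y e) (t e) u (x' e) (y' e) (t' e) u').
Proof.
move=> hp; have C0 := lt0r_neq0 hCperp; have := jt; rewrite hp => jt0.
by apply: jet_eq; last (rewrite /torque; clear jt; jets); rewrite /kappa; field.
Qed.

End FirstOrder.

(* For [a = 1] and [b = cos phi], [xi a b] and [- xi b a] are the coefficients of
   [(cos th0, sin th0)] in the paper's [(xi_1, eta_1)] and [(xi_2, eta_2)], and
   [vth a b] is its [vartheta_1 = vartheta_2]. *)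
Definition xi (a b : R) : R :=
  L * lam * (a - b) / (128 * Cpar * Cperp * (1 - lam ^+ 2)) *
  ((Cperp ^+ 2 * (2 + lam) - Cpar * Cperp) * a
   + (3 * Cpar ^+ 2 - 2 * Cperp * Cpar - Cperp ^+ 2) * b).

Definition vth (a b : R) : R := - (lam / (32 * (1 - lam))) * (a - b).

(* [x], [y], [t] belong to the field actuating the scallop under consideration,
   [X], [Y], [T] to the one actuating the other scallop, [bx], [by_], [bt] to
   their Lie bracket. *)
Section SecondOrder.
Variables (a b p p' q q' : R) (C S C' S' x y t x' y' t' X Y T X' Y' T'
  bx by_ bt bx' by' bt' : R -> R).
Hypotheses (jC : jet C (-1) 0 (a ^+ 2 / 2)) (jS : jet S 0 (- a) 0)
  (jC' : jet C' (-1) 0 (b ^+ 2 / 2)) (jS' : jet S' 0 (- b) 0)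
  (jx : jet x 0 (- (L / 8) * a) 0)
  (jy : jet y (L / 4) 0 (- (L / 4) * (Cpar * a ^+ 2 / (4 * Cperp))))
  (jt : jet t (- (1 / 2)) 0 p)
  (jx' : jet x' 0 0 0) (jy' : jet y' 0 0 0) (jt' : jet t' 0 0 p')
  (jX : jet X 0 0 0) (jY : jet Y 0 0 0) (jT : jet T 0 0 q)
  (jX' : jet X' 0 (- (L / 8) * b) 0)
  (jY' : jet Y' (L / 4) 0 (- (L / 4) * (Cpar * b ^+ 2 / (4 * Cperp))))
  (jT' : jet T' (- (1 / 2)) 0 q')
  (jbx : jet bx 0 0 (xi a b)) (jby : jet by_ 0 0 0) (jbt : jet bt 0 (vth a b) 0)
  (jbx' : jet bx' 0 0 (- xi b a)) (jby' : jet by' 0 0 0) (jbt' : jet bt' 0 (vth a b) 0).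
Hypotheses (hp : p = lam ^+ 2 * kappa a b / (1 - lam ^+ 2))
  (hp' : p' = lam * kappa a b / (1 - lam ^+ 2))
  (hq : q = lam * kappa b a / (1 - lam ^+ 2))
  (hq' : q' = lam ^+ 2 * kappa b a / (1 - lam ^+ 2)).

Let neq0 : [/\ Cperp != 0, Cpar != 0, 1 - lam ^+ 2 != 0, 1 - lam != 0 & 1 + lam != 0].
Proof.
case/andP: hlam => l0 l1; split; try exact: lt0r_neq0; first exact: lam2_neq0.
  by rewrite lt0r_neq0 ?subr_gt0.
by rewrite lt0r_neq0 ?addr_gt0.
Qed.

(** Subtracting the two differentiated balances, of each field along the other, shows that this
    expression vanishes at the exact bracket. Here [bx], [by_], [bt] are the ansatz, and the
    residual is of higher order. The link rates are [t], [t + 1] along the first field and [T],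
    [T + 0] along the second. *)
Lemma small_bracket_forceX : small (fun e =>
  forceX 1 0 (C e) (S e) (bx e) (by_ e) (bt e) 0
  + (dforceX 1 0 (C e) (S e) 0 (t e) (- S e * (t e + 1)) (C e * (t e + 1))
       (X e) (Y e) (T e) 0
     - dforceX 1 0 (C e) (S e) 0 (T e) (- S e * (T e + 0)) (C e * (T e + 0))
       (x e) (y e) (t e) 1)).
Proof.
have [C0 D0 l2 l1 l1'] := neq0.
apply: jet_eq; last (rewrite /forceX /dforceX; jets);
  rewrite ?hp ?hp' ?hq ?hq' /xi /vth /kappa; by field; rewrite ?C0 ?D0 ?l2 ?l1.
Qed.

Lemma small_bracket_forceY : small (fun e =>
  forceY 1 0 (C e) (S e) (bx e) (by_ e) (bt e) 0
  + (dforceY 1 0 (C e) (S e) 0 (t e) (- S e * (t e + 1)) (C e * (t e + 1))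
       (X e) (Y e) (T e) 0
     - dforceY 1 0 (C e) (S e) 0 (T e) (- S e * (T e + 0)) (C e * (T e + 0))
       (x e) (y e) (t e) 1)).
Proof.
have [C0 D0 l2 l1 l1'] := neq0.
apply: jet_eq; last (rewrite /forceY /dforceY; jets);
  rewrite ?hp ?hp' ?hq ?hq' /xi /vth /kappa; by field; rewrite ?C0 ?D0 ?l2 ?l1.
Qed.

Lemma small_bracket_torque : small (fun e =>
  torque 1 0 (C e) (S e) 1 0 (C' e) (S' e)
    (bx e) (by_ e) (bt e) 0 (bx' e) (by' e) (bt' e) 0
  + (dtorque 1 0 (C e) (S e) 0 (t e) (- S e * (t e + 1)) (C e * (t e + 1))
      1 0 (C' e) (S' e) 0 (t' e) (- S' e * (t' e + 0)) (C' e * (t' e + 0))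
      (X e) (Y e) (X' e) (Y' e) (T' e) 1
    - dtorque 1 0 (C e) (S e) 0 (T e) (- S e * (T e + 0)) (C e * (T e + 0))
      1 0 (C' e) (S' e) 0 (T' e) (- S' e * (T' e + 1)) (C' e * (T' e + 1))
      (x e) (y e) (x' e) (y' e) (t' e) 0)).
Proof.
have [C0 D0 l2 l1 l1'] := neq0.
apply: jet_eq; last (rewrite /torque /dtorque; jets);
  rewrite ?hp ?hp' ?hq ?hq' /xi /vth /kappa; by field; rewrite ?C0 ?D0 ?l2 ?l1.
Qed.

End SecondOrder.

(** * Covariance of the balance laws under a change of frame *)

Section Rotation.
Variables (p q : R).
Hypothesis pq1 : p ^+ 2 + q ^+ 2 = 1.

(** Writing the missing factor 1 as [p ^+ 2 + q ^+ 2] turns this into a polynomial identity; the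
    same device recurs throughout the section. *)
Let dotE (c s x y : R) :
  (p * c + q * s) * (p * x + q * y) + (p * s - q * c) * (p * y - q * x) = c * x + s * y.
Proof. by rewrite -[RHS]mul1r -pq1; ring. Qed.

Let crossE (c s x y : R) :
  (p * c + q * s) * (p * y - q * x) - (p * s - q * c) * (p * x + q * y) = c * y - s * x.
Proof. by rewrite -[RHS]mul1r -pq1; ring. Qed.

(** A force is built from scalar products, link directions and their quarter turns, so it rotates
    with the frame. The torque is built from scalar and cross products only, so it is invariant. *)
Lemma forceX_rot (c1 s1 c2 s2 x y t u : R) :
  forceX (p * c1 + q * s1) (p * s1 - q * c1)
    (p * c2 + q * s2) (p * s2 - q * c2) (p * x + q * y) (p * y - q * x) t u =
  p * forceX c1 s1 c2 s2 x y t u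
  + q * forceY c1 s1 c2 s2 x y t u.
Proof. by rewrite /forceX /forceY !dotE; ring. Qed.

Lemma forceY_rot (c1 s1 c2 s2 x y t u : R) :
  forceY (p * c1 + q * s1) (p * s1 - q * c1)
    (p * c2 + q * s2) (p * s2 - q * c2) (p * x + q * y) (p * y - q * x) t u =
  p * forceY c1 s1 c2 s2 x y t u
  - q * forceX c1 s1 c2 s2 x y t u.
Proof. by rewrite /forceX /forceY !dotE; ring. Qed.

Lemma torque_rot (c1 s1 c2 s2 c1' s1' c2' s2' x y t u x' y' t' u' : R) :
  torque (p * c1 + q * s1) (p * s1 - q * c1)
    (p * c2 + q * s2) (p * s2 - q * c2)
    (p * c1' + q * s1') (p * s1' - q * c1') (p * c2' + q * s2') (p * s2' - q * c2')
    (p * x + q * y) (p * y - q * x) t u (p * x' + q * y') (p * y' - q * x') t' u' =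
  torque c1 s1 c2 s2 c1' s1' c2' s2' x y t u x' y' t' u'.
Proof.
rewrite /torque !crossE !dotE.
have lever (a b : R) :
    (p * c1 + q * s1 + (p * c2 + q * s2)) * (p * b - q * a)
    - (p * s1 - q * c1 + (p * s2 - q * c2)) * (p * a + q * b) =
    (c1 + c2) * b - (s1 + s2) * a by rewrite -[RHS]mul1r -pq1; ring.
have dotDE w c s x0 y0 : w + (p * c + q * s) * (p * x0 + q * y0)
    + (p * s - q * c) * (p * y0 - q * x0) = w + c * x0 + s * y0.
  by rewrite -addrA dotE addrA.
by rewrite !lever !dotDE.
Qed.

Lemma balanced_rot (c1 s1 c2 s2 c1' s1' c2' s2' x y t u x' y' t' u' : R) :
  balanced c1 s1 c2 s2 c1' s1' c2' s2' x y t u x' y' t' u' ->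
  balanced (p * c1 + q * s1) (p * s1 - q * c1)
    (p * c2 + q * s2) (p * s2 - q * c2)
    (p * c1' + q * s1') (p * s1' - q * c1') (p * c2' + q * s2') (p * s2' - q * c2')
    (p * x + q * y) (p * y - q * x) t u (p * x' + q * y') (p * y' - q * x') t' u'.
Proof.
by move=> [fx fy tq]; split; rewrite ?forceX_rot ?forceY_rot ?torque_rot//
  fx fy !mulr0 ?addr0 ?subr0.
Qed.

(** Quarter turns commute with rotations, so the derivatives of the link directions rotate like the
    directions themselves. *)
Lemma dforceX_rot (c1 s1 c2 s2 k l x y t u : R) :
  let C1 := p * c1 + q * s1 in let S1 := p * s1 - q * c1 in
  let C2 := p * c2 + q * s2 in let S2 := p * s2 - q * c2 in
  dforceX C1 S1 C2 S2 (- S1 * k) (C1 * k) (- S2 * l) (C2 * l)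
    (p * x + q * y) (p * y - q * x) t u =
  p * dforceX c1 s1 c2 s2 (- s1 * k) (c1 * k) (- s2 * l) (c2 * l) x y t u
  + q * dforceY c1 s1 c2 s2 (- s1 * k) (c1 * k) (- s2 * l) (c2 * l) x y t u.
Proof.
have dE c s r : - (p * s - q * c) * r * (p * x + q * y)
   + (p * c + q * s) * r * (p * y - q * x) = r * (c * y - s * x).
  by rewrite -[RHS]mul1r -pq1; ring.
by rewrite /= /dforceX /dforceY !dotE !dE; ring.
Qed.

Lemma dforceY_rot (c1 s1 c2 s2 k l x y t u : R) :
  let C1 := p * c1 + q * s1 in let S1 := p * s1 - q * c1 in
  let C2 := p * c2 + q * s2 in let S2 := p * s2 - q * c2 in
  dforceY C1 S1 C2 S2 (- S1 * k) (C1 * k) (- S2 * l) (C2 * l)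
    (p * x + q * y) (p * y - q * x) t u =
  p * dforceY c1 s1 c2 s2 (- s1 * k) (c1 * k) (- s2 * l) (c2 * l) x y t u
  - q * dforceX c1 s1 c2 s2 (- s1 * k) (c1 * k) (- s2 * l) (c2 * l) x y t u.
Proof.
have dE c s r : - (p * s - q * c) * r * (p * x + q * y)
   + (p * c + q * s) * r * (p * y - q * x) = r * (c * y - s * x).
  by rewrite -[RHS]mul1r -pq1; ring.
by rewrite /= /dforceX /dforceY !dotE !dE; ring.
Qed.

Lemma dtorque_rot (c1 s1 c2 s2 k l c1' s1' c2' s2' k' l' x y x' y' t' u' : R) :
  let C1 := p * c1 + q * s1 in let S1 := p * s1 - q * c1 in
  let C2 := p * c2 + q * s2 in let S2 := p * s2 - q * c2 in
  let C1' := p * c1' + q * s1' in let S1' := p * s1' - q * c1' in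
  let C2' := p * c2' + q * s2' in let S2' := p * s2' - q * c2' in
  dtorque C1 S1 C2 S2 (- S1 * k) (C1 * k) (- S2 * l) (C2 * l)
    C1' S1' C2' S2' (- S1' * k') (C1' * k') (- S2' * l') (C2' * l')
    (p * x + q * y) (p * y - q * x) (p * x' + q * y') (p * y' - q * x') t' u' =
  dtorque c1 s1 c2 s2 (- s1 * k) (c1 * k) (- s2 * l) (c2 * l)
    c1' s1' c2' s2' (- s1' * k') (c1' * k') (- s2' * l') (c2' * l')
    x y x' y' t' u'.
Proof.
have dE c s r a b : - (p * s - q * c) * r * (p * a + q * b)
   + (p * c + q * s) * r * (p * b - q * a) = - s * r * a + c * r * b.
  by rewrite -[RHS]mul1r -pq1; ring.
have dcE c s c' s' r r' : - (p * s - q * c) * r * (p * s' - q * c')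
    + (p * c + q * s) * ((p * c' + q * s') * r')
    - ((p * c + q * s) * r * (p * c' + q * s') + (p * s - q * c) * (- (p * s' - q * c') * r'))
    = - s * r * s' + c * (c' * r') - (c * r * c' + s * (- s' * r')).
  by rewrite -[RHS]mul1r -pq1; ring.
have ddE c s c' s' r r' : - (p * s - q * c) * r * (p * c' + q * s')
    + (p * c + q * s) * (- (p * s' - q * c') * r')
    + ((p * c + q * s) * r * (p * s' - q * c') + (p * s - q * c) * ((p * c' + q * s') * r'))
    = - s * r * c' + c * (- s' * r') + (c * r * s' + s * (c' * r')).
  by rewrite -[RHS]mul1r -pq1; ring.
have lever (a b : R) :
    (- (p * s1 - q * c1) * k + - (p * s2 - q * c2) * l) * (p * b - q * a)
    - ((p * c1 + q * s1) * k + (p * c2 + q * s2) * l) * (p * a + q * b) =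
    (- s1 * k + - s2 * l) * b - (c1 * k + c2 * l) * a.
  by rewrite -[RHS]mul1r -pq1; ring.
by rewrite /= /dtorque !dcE !ddE !dotE !crossE !dE !lever.
Qed.

Lemma dbalanced_rot (c1 s1 c2 s2 k l c1' s1' c2' s2' k' l'
    x y t u x' y' t' u' dx dy dt dx' dy' dt' : R) :
  dbalanced c1 s1 c2 s2 k l c1' s1' c2' s2' k' l'
    x y t u x' y' t' u' dx dy dt dx' dy' dt' ->
  dbalanced (p * c1 + q * s1) (p * s1 - q * c1)
    (p * c2 + q * s2) (p * s2 - q * c2) k l
    (p * c1' + q * s1') (p * s1' - q * c1') (p * c2' + q * s2') (p * s2' - q * c2') k' l'
    (p * x + q * y) (p * y - q * x) t u (p * x' + q * y') (p * y' - q * x') t' u'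
    (p * dx + q * dy) (p * dy - q * dx) dt (p * dx' + q * dy') (p * dy' - q * dx') dt'.
Proof.
move=> [fx fy tq]; split.
- rewrite forceX_rot dforceX_rot addrACA -!mulrDr fx fy; ring.
- rewrite forceY_rot dforceY_rot addrACA -opprD -!mulrDr fx fy; ring.
- by rewrite torque_rot dtorque_rot.
Qed.

End Rotation.

(** * From small residuals to small errors *)

Section Stability.
Variables (a b : R).

Let C1 (e : R) := - cos (a * e).
Let S1 (e : R) := - sin (a * e).
Let C2 (e : R) := - cos (b * e).
Let S2 (e : R) := - sin (b * e).

(* The resistance matrix is continuous and invertible up to [e = 0]. *)
Lemma small_velocities (X1 Y1 T1 X2 Y2 T2 : R -> R) :
  small (fun e => forceX 1 0 (C1 e) (S1 e) (X1 e) (Y1 e) (T1 e) 0) ->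
  small (fun e => forceY 1 0 (C1 e) (S1 e) (X1 e) (Y1 e) (T1 e) 0) ->
  small (fun e => torque 1 0 (C1 e) (S1 e) 1 0 (C2 e) (S2 e)
    (X1 e) (Y1 e) (T1 e) 0 (X2 e) (Y2 e) (T2 e) 0) ->
  small (fun e => forceX 1 0 (C2 e) (S2 e) (X2 e) (Y2 e) (T2 e) 0) ->
  small (fun e => forceY 1 0 (C2 e) (S2 e) (X2 e) (Y2 e) (T2 e) 0) ->
  small (fun e => torque 1 0 (C2 e) (S2 e) 1 0 (C1 e) (S1 e)
    (X2 e) (Y2 e) (T2 e) 0 (X1 e) (Y1 e) (T1 e) 0) ->
  [/\ small X1, small Y1 & small T1] /\ [/\ small X2, small Y2 & small T2].
Proof.
move=> hX1 hY1 hT1 hX2 hY2 hT2.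
pose M e := resistance L Cpar Cperp lam 0 0 (pi + a * e) (pi + b * e).
pose y e := mkvel (X1 e) (Y1 e) (T1 e) (X2 e) (Y2 e) (T2 e).
have My (i : 'I_6) : small (fun e => (M e *m y e) i 0).
  (* With zero orientations the first links point along (1, 0) and the second ones along [(C1, S1)]
     and [(C2, S2)]; with zero controls the driving terms disappear. *)
  have ME e := resistance_mkvel 0 0 (pi + a * e) (pi + b * e)
    (X1 e) (Y1 e) (T1 e) (X2 e) (Y2 e) (T2 e) 0 0.
  have sub (f g : R -> R) : small f -> small g ->
      small (fun e => L * (f e - lam * g e)).
    move=> sf sg; apply: smallZ; apply: smallD => //.
    have := smallZ (- lam) sg; congr small; apply/funext => e; ring.
  have -> : (fun e => (M e *m y e) i 0) = (fun e => mkvel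
      (L * (forceX 1 0 (C1 e) (S1 e) (X1 e) (Y1 e) (T1 e) 0
            - lam * forceX 1 0 (C2 e) (S2 e) (X2 e) (Y2 e) (T2 e) 0))
      (L * (forceY 1 0 (C1 e) (S1 e) (X1 e) (Y1 e) (T1 e) 0
            - lam * forceY 1 0 (C2 e) (S2 e) (X2 e) (Y2 e) (T2 e) 0))
      (torque 1 0 (C1 e) (S1 e) 1 0 (C2 e) (S2 e)
        (X1 e) (Y1 e) (T1 e) 0 (X2 e) (Y2 e) (T2 e) 0)
      (L * (forceX 1 0 (C2 e) (S2 e) (X2 e) (Y2 e) (T2 e) 0
            - lam * forceX 1 0 (C1 e) (S1 e) (X1 e) (Y1 e) (T1 e) 0))
      (L * (forceY 1 0 (C2 e) (S2 e) (X2 e) (Y2 e) (T2 e) 0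
            - lam * forceY 1 0 (C1 e) (S1 e) (X1 e) (Y1 e) (T1 e) 0))
      (torque 1 0 (C2 e) (S2 e) 1 0 (C1 e) (S1 e)
        (X2 e) (Y2 e) (T2 e) 0 (X1 e) (Y1 e) (T1 e) 0) i 0).
    apply/funext => e; have := ME e.
    rewrite /= !scale0r !addr0 cos0 sin0 !add0r !cos_pi_add !sin_pi_add => <-.
    by [].
  under [X in small X]eq_fun do rewrite mkvelE.
  case: i => [[|[|[|[|[|[|]]]]]]] //= _; first [exact: sub|by []].
have dM : mxdiff (0 : R) M.
  apply: mxdiff_resistance; try exact: differentiable_cst.
    apply: differentiableD; first exact: differentiable_cst.
    by apply: differentiableM; first exact: differentiable_cst.
  apply: differentiableD; first exact: differentiable_cst.
  by apply: differentiableM; first exact: differentiable_cst.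
have dI : mxdiff (0 : R) (fun e => invmx (M e)) by apply: mxdiff_inv => // e; exact: hinv.
have sy (i : 'I_6) : small (fun e => y e i 0).
  have -> : (fun e => y e i 0) =
      (fun e => \sum_j invmx (M e) i j * (M e *m y e) j 0).
    by apply/funext => e; rewrite -[in LHS](mulKmx (hinv _ _ _ _ : M e \in unitmx) (y e)) mxE.
  apply: small_sum => j; apply: (smallM (l := invmx (M 0) i j)) => //.
  apply: cvg_at_right_filter.
  exact: (differentiable_continuous (dI i j)).
have get k (f : R -> R) (hk : (k < 6)%N) :
    (fun e => y e (Ordinal hk) 0) = f -> small f by move=> <-.
by split; split; [apply: (@get 0%N)|apply: (@get 1%N)|apply: (@get 2%N)
  |apply: (@get 3%N)|apply: (@get 4%N)|apply: (@get 5%N)] => //;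
  move=> *; apply/funext => e; rewrite mkvelE.
Qed.

End Stability.

Section AffineBalance.
Variables (u u' c1 s1 c2 s2 c1' s1' c2' s2' : R).

(** The balance laws are affine in the velocity, the control giving the constant term. The
    difference of two velocities with the same control thus obeys the homogeneous law, to which
    [small_velocities] applies. *)
Lemma forceX_sub (x y t x0 y0 t0 : R) :
  forceX c1 s1 c2 s2 (x - x0) (y - y0) (t - t0) 0 =
  forceX c1 s1 c2 s2 x y t u - forceX c1 s1 c2 s2 x0 y0 t0 u.
Proof. by rewrite /forceX; ring. Qed.

Lemma forceY_sub (x y t x0 y0 t0 : R) :
  forceY c1 s1 c2 s2 (x - x0) (y - y0) (t - t0) 0 =
  forceY c1 s1 c2 s2 x y t u - forceY c1 s1 c2 s2 x0 y0 t0 u.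
Proof. by rewrite /forceY; ring. Qed.

Lemma torque_sub (x y t x' y' t' x0 y0 t0 x0' y0' t0' : R) :
  torque c1 s1 c2 s2 c1' s1' c2' s2'
    (x - x0) (y - y0) (t - t0) 0 (x' - x0') (y' - y0') (t' - t0') 0 =
  torque c1 s1 c2 s2 c1' s1' c2' s2' x y t u x' y' t' u'
  - torque c1 s1 c2 s2 c1' s1' c2' s2' x0 y0 t0 u x0' y0' t0' u'.
Proof. by rewrite /torque; ring. Qed.

Lemma forceX_opp (x y t : R) :
  forceX c1 s1 c2 s2 (- x) (- y) (- t) 0 =
  - forceX c1 s1 c2 s2 x y t 0.
Proof. by rewrite /forceX; ring. Qed.

Lemma forceY_opp (x y t : R) :
  forceY c1 s1 c2 s2 (- x) (- y) (- t) 0 =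
  - forceY c1 s1 c2 s2 x y t 0.
Proof. by rewrite /forceY; ring. Qed.

Lemma torque_opp (x y t x' y' t' : R) :
  torque c1 s1 c2 s2 c1' s1' c2' s2'
    (- x) (- y) (- t) 0 (- x') (- y') (- t') 0 =
  - torque c1 s1 c2 s2 c1' s1' c2' s2' x y t 0 x' y' t' 0.
Proof. by rewrite /torque; ring. Qed.

End AffineBalance.
Arguments forceX_sub u {c1 s1 c2 s2}.
Arguments forceY_sub u {c1 s1 c2 s2}.
Arguments torque_sub u u' {c1 s1 c2 s2 c1' s1' c2' s2'}.

(** * Expansion of the Lie bracket *)

Section BracketExpansion.
Variables (th0 a b : R).

Let C1 (e : R) := - cos (a * e).
Let S1 (e : R) := - sin (a * e).
Let C2 (e : R) := - cos (b * e).
Let S2 (e : R) := - sin (b * e).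

Let jC1 : jet C1 (-1) 0 (a ^+ 2 / 2).
Proof. by apply: jet_eq (jetN (jet_cos a)); rewrite ?oppr0 ?opprK. Qed.
Let jS1 : jet S1 0 (- a) 0.
Proof. by apply: jet_eq (jetN (jet_sin a)); rewrite ?oppr0. Qed.
Let jC2 : jet C2 (-1) 0 (b ^+ 2 / 2).
Proof. by apply: jet_eq (jetN (jet_cos b)); rewrite ?oppr0 ?opprK. Qed.
Let jS2 : jet S2 0 (- b) 0.
Proof. by apply: jet_eq (jetN (jet_sin b)); rewrite ?oppr0. Qed.

(* The initial state is the case [a = 1], [b = cos phi]; with general [a] and [b]
   the two scallops play symmetric roles. *)
Definition near_straight (e : R) : 'cV[R]_8 :=
  mkstate 0 th0 0 th0 (pi + a * e) (pi + b * e).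

(* Coordinates of the two hinge velocities in the frame rotated by [th0]. *)
Definition rx1 (V : 'cV[R]_8) := cos th0 * V (inord 0) 0 + sin th0 * V (inord 1) 0.
Definition ry1 (V : 'cV[R]_8) := cos th0 * V (inord 1) 0 - sin th0 * V (inord 0) 0.
Definition rx2 (V : 'cV[R]_8) := cos th0 * V (inord 3) 0 + sin th0 * V (inord 4) 0.
Definition ry2 (V : 'cV[R]_8) := cos th0 * V (inord 4) 0 - sin th0 * V (inord 3) 0.

Let pq1 : cos th0 ^+ 2 + sin th0 ^+ 2 = 1.
Proof. exact: cos2Dsin2. Qed.

Let rotE x : [/\ cos th0 * cos (th0 + (pi + x)) + sin th0 * sin (th0 + (pi + x)) = - cos x,
  cos th0 * sin (th0 + (pi + x)) - sin th0 * cos (th0 + (pi + x)) = - sin x,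
  cos th0 * cos th0 + sin th0 * sin th0 = 1 &
  cos th0 * sin th0 - sin th0 * cos th0 = 0].
Proof.
split.
- by rewrite -cos_pi_add -[pi + x in RHS](addKr th0) [- th0 + _]addrC cosB; ring.
- by rewrite -sin_pi_add -[pi + x in RHS](addKr th0) [- th0 + _]addrC sinB; ring.
- by rewrite -pq1 !expr2.
- by rewrite mulrC subrr.
Qed.

Let near_straightE e : [/\ theta1 (near_straight e) = th0, theta2 (near_straight e) = th0,
  sigma1 (near_straight e) = pi + a * e & sigma2 (near_straight e) = pi + b * e].
Proof. by split; rewrite /theta1 /theta2 /sigma1 /sigma2 mxE inordK. Qed.

Lemma field_balanced_rot u1 u2 e (F := field u1 u2 (near_straight e)) :
  balanced 1 0 (C1 e) (S1 e) 1 0 (C2 e) (S2 e)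
    (rx1 F) (ry1 F) (theta1 F) u1 (rx2 F) (ry2 F) (theta2 F) u2 /\
  balanced 1 0 (C2 e) (S2 e) 1 0 (C1 e) (S1 e)
    (rx2 F) (ry2 F) (theta2 F) u2 (rx1 F) (ry1 F) (theta1 F) u1.
Proof.
have := field_balanced u1 u2 (near_straight e).
have [-> -> -> ->] := near_straightE e.
have [r1 r2 r3 r4] := rotE (a * e); have [r1' r2' _ _] := rotE (b * e).
move=> [/(balanced_rot pq1) + /(balanced_rot pq1)].
by rewrite !r1 !r2 !r3 !r4 !r1' !r2'.
Qed.

Lemma field_dbalanced_rot a1 a2 b1 b2 e (z := near_straight e)
    (H := field a1 a2 z) (F := field b1 b2 z) (D := 'd (field b1 b2) z H) :
  dbalanced 1 0 (C1 e) (S1 e) (theta1 H) (theta1 H + a1)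
    1 0 (C2 e) (S2 e) (theta2 H) (theta2 H + a2)
    (rx1 F) (ry1 F) (theta1 F) b1 (rx2 F) (ry2 F) (theta2 F) b2
    (rx1 D) (ry1 D) (theta1 D) (rx2 D) (ry2 D) (theta2 D) /\
  dbalanced 1 0 (C2 e) (S2 e) (theta2 H) (theta2 H + a2)
    1 0 (C1 e) (S1 e) (theta1 H) (theta1 H + a1)
    (rx2 F) (ry2 F) (theta2 F) b2 (rx1 F) (ry1 F) (theta1 F) b1
    (rx2 D) (ry2 D) (theta2 D) (rx1 D) (ry1 D) (theta1 D).
Proof.
have := field_dbalanced a1 a2 b1 b2 (near_straight e).
have [-> -> -> ->] := near_straightE e.
have [r1 r2 r3 r4] := rotE (a * e); have [r1' r2' _ _] := rotE (b * e).
move=> [/(dbalanced_rot pq1) + /(dbalanced_rot pq1)].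
by rewrite !r1 !r2 !r3 !r4 !r1' !r2'.
Qed.

Let quad (c0 c1 c2 e : R) := c0 + c1 * e + c2 * e ^+ 2.

Lemma jet_field u1 u2 (F := fun e => field u1 u2 (near_straight e)) :
  [/\ jet (fun e => rx1 (F e)) 0 (- (L / 8) * u1 * a) 0,
      jet (fun e => ry1 (F e)) (L * u1 / 4) 0
        (- (L * u1 / 4) * (Cpar * a ^+ 2 / (4 * Cperp))) &
      jet (fun e => theta1 (F e)) (- (u1 / 2)) 0
        ((lam ^+ 2 * kappa a b * u1 + lam * kappa b a * u2) / (1 - lam ^+ 2))] /\
  [/\ jet (fun e => rx2 (F e)) 0 (- (L / 8) * u2 * b) 0,
      jet (fun e => ry2 (F e)) (L * u2 / 4) 0
        (- (L * u2 / 4) * (Cpar * b ^+ 2 / (4 * Cperp))) &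
      jet (fun e => theta2 (F e)) (- (u2 / 2)) 0
        ((lam * kappa a b * u1 + lam ^+ 2 * kappa b a * u2) / (1 - lam ^+ 2))].
Proof.
set p1 := (_ / (1 - lam ^+ 2)); set p2 := (_ / (1 - lam ^+ 2)).
(* [p1] and [p2] are the solution of the 2x2 system formed by the two equations below, of
   determinant [1 - lam ^+ 2]. *)
have l2 := lam2_neq0.
have hp1 : p1 = lam * (p2 + kappa b a * u2) by rewrite /p1 /p2; field.
have hp2 : p2 = lam * (p1 + kappa a b * u1) by rewrite /p1 /p2; field.
have jq c0 c1 c2 : jet (quad c0 c1 c2) c0 c1 c2 by exact: jet_poly.
have bal e := field_balanced_rot u1 u2 e.
have := @small_velocities a b
  (fun e => rx1 (F e) - quad 0 (- (L / 8) * u1 * a) 0 e)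
  (fun e => ry1 (F e) - quad (L * u1 / 4) 0
        (- (L * u1 / 4) * (Cpar * a ^+ 2 / (4 * Cperp))) e)
  (fun e => theta1 (F e) - quad (- (u1 / 2)) 0 p1 e)
  (fun e => rx2 (F e) - quad 0 (- (L / 8) * u2 * b) 0 e)
  (fun e => ry2 (F e) - quad (L * u2 / 4) 0
        (- (L * u2 / 4) * (Cpar * b ^+ 2 / (4 * Cperp))) e)
  (fun e => theta2 (F e) - quad (- (u2 / 2)) 0 p2 e).
case.
(* The exact field has zero residual, so the residual of the error is minus that of the quadratic
   ansatz; likewise in the other five cases. *)
- apply: (small_eqN (small_forceX jC1 jS1 (jq _ _ _) (jq _ _ _) (jq _ _ p1))) => e.
  by have [[h _ _] _] := bal e; rewrite (forceX_sub u1) h sub0r.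
- apply: (small_eqN (small_forceY jC1 jS1 (jq _ _ _) (jq _ _ _) (jq _ _ p1))) => e.
  by have [[_ h _] _] := bal e; rewrite (forceY_sub u1) h sub0r.
- apply: (small_eqN (small_torque jC1 jS1 jC2 jS2 (jq _ _ _) (jq _ _ _) (jq _ _ _)
    (jq _ _ _) (jq _ _ _) (jq _ _ _) hp1)) => e.
  by have [[_ _ h] _] := bal e; rewrite (torque_sub u1 u2) h sub0r.
- apply: (small_eqN (small_forceX jC2 jS2 (jq _ _ _) (jq _ _ _) (jq _ _ p2))) => e.
  by have [_ [h _ _]] := bal e; rewrite (forceX_sub u2) h sub0r.
- apply: (small_eqN (small_forceY jC2 jS2 (jq _ _ _) (jq _ _ _) (jq _ _ p2))) => e.
  by have [_ [_ h _]] := bal e; rewrite (forceY_sub u2) h sub0r.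
- apply: (small_eqN (small_torque jC2 jS2 jC1 jS1 (jq _ _ _) (jq _ _ _) (jq _ _ _)
    (jq _ _ _) (jq _ _ _) (jq _ _ _) hp2)) => e.
  by have [_ [_ _ h]] := bal e; rewrite (torque_sub u2 u1) h sub0r.
by move=> [sx1 sy1 st1] [sx2 sy2 st2]; split; split; apply: jet_of_small (jq _ _ _) _.
Qed.

Lemma jet_bracket
    (B := fun e => lie_bracket (field 1 0) (field 0 1) (near_straight e)) :
  [/\ jet (fun e => rx1 (B e)) 0 0 (xi a b), jet (fun e => ry1 (B e)) 0 0 0 &
      jet (fun e => theta1 (B e)) 0 (vth a b) 0] /\
  [/\ jet (fun e => rx2 (B e)) 0 0 (- xi b a), jet (fun e => ry2 (B e)) 0 0 0 &
      jet (fun e => theta2 (B e)) 0 (vth a b) 0].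
Proof.
pose F10 e := field 1 0 (near_straight e); pose F01 e := field 0 1 (near_straight e).
pose D01 e := 'd (field 0 1) (near_straight e) (F10 e).
pose D10 e := 'd (field 1 0) (near_straight e) (F01 e).
have BE e : B e = D01 e - D10 e by [].
have subE (U V : 'cV[R]_8) i : (U - V) i 0 = U i 0 - V i 0 by rewrite !mxE.
have rx1B e : rx1 (B e) = rx1 (D01 e) - rx1 (D10 e).
  by rewrite BE /rx1 !subE; ring.
have ry1B e : ry1 (B e) = ry1 (D01 e) - ry1 (D10 e).
  by rewrite BE /ry1 !subE; ring.
have t1B e : theta1 (B e) = theta1 (D01 e) - theta1 (D10 e).
  by rewrite BE /theta1 !subE.
have rx2B e : rx2 (B e) = rx2 (D01 e) - rx2 (D10 e).
  by rewrite BE /rx2 !subE; ring.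
have ry2B e : ry2 (B e) = ry2 (D01 e) - ry2 (D10 e).
  by rewrite BE /ry2 !subE; ring.
have t2B e : theta2 (B e) = theta2 (D01 e) - theta2 (D10 e).
  by rewrite BE /theta2 !subE.
have jq c0 c1 c2 : jet (quad c0 c1 c2) c0 c1 c2 by exact: jet_poly.
have jqN c0 c1 c2 d0 d1 d2 : - c0 = d0 -> - c1 = d1 -> - c2 = d2 ->
    jet (fun e => - quad c0 c1 c2 e) d0 d1 d2.
  by move=> <- <- <-; apply: jetN; exact: jq.
have vthC : - vth a b = vth b a by rewrite /vth; ring.
pose p := lam ^+ 2 * kappa a b / (1 - lam ^+ 2).
pose p' := lam * kappa a b / (1 - lam ^+ 2).
pose q := lam * kappa b a / (1 - lam ^+ 2).
pose q' := lam ^+ 2 * kappa b a / (1 - lam ^+ 2).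
have [[jx jy jt] [jx' jy' jt']] : [/\ jet (fun e => rx1 (F10 e)) 0 (- (L / 8) * a) 0,
   jet (fun e => ry1 (F10 e)) (L / 4) 0 (- (L / 4) * (Cpar * a ^+ 2 / (4 * Cperp))) &
   jet (fun e => theta1 (F10 e)) (- (1 / 2)) 0 p] /\ [/\
   jet (fun e => rx2 (F10 e)) 0 0 0, jet (fun e => ry2 (F10 e)) 0 0 0 &
   jet (fun e => theta2 (F10 e)) 0 0 p'].
  have [[h1 h2 h3] [h4 h5 h6]] := jet_field 1 0.
  split; split; [apply: jet_eq h1|apply: jet_eq h2|apply: jet_eq h3|apply: jet_eq h4
    |apply: jet_eq h5|apply: jet_eq h6]; rewrite /p /p' ?(mulr0, mul0r, addr0, mulr1, oppr0)//.
have [[jX jY jT] [jX' jY' jT']] : [/\ jet (fun e => rx1 (F01 e)) 0 0 0,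
   jet (fun e => ry1 (F01 e)) 0 0 0 & jet (fun e => theta1 (F01 e)) 0 0 q] /\ [/\
   jet (fun e => rx2 (F01 e)) 0 (- (L / 8) * b) 0,
   jet (fun e => ry2 (F01 e)) (L / 4) 0 (- (L / 4) * (Cpar * b ^+ 2 / (4 * Cperp))) &
   jet (fun e => theta2 (F01 e)) (- (1 / 2)) 0 q'].
  have [[h1 h2 h3] [h4 h5 h6]] := jet_field 0 1.
  split; split; [apply: jet_eq h1|apply: jet_eq h2|apply: jet_eq h3|apply: jet_eq h4
    |apply: jet_eq h5|apply: jet_eq h6];
    rewrite /q /q' ?(mulr0, mul0r, addr0, add0r, mulr1, oppr0)//.
have bal01 e := field_dbalanced_rot 1 0 0 1 e.
have bal10 e := field_dbalanced_rot 0 1 1 0 e.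
(* [f1], [f2] are the forces or torques of the two derivatives whose difference is the bracket,
   [d1], [d2] the terms from the moving links, and [g] the value at the ansatz. *)
have solve (f1 f2 d1 d2 g : R) : f1 + d1 = 0 -> f2 + d2 = 0 ->
    f1 - f2 - g = - (g + (d1 - d2)).
  move=> /eqP; rewrite addr_eq0 => /eqP -> /eqP; rewrite addr_eq0 => /eqP ->; ring.
have solve2 (f1 f2 d1 d2 g : R) : f1 + d1 = 0 -> f2 + d2 = 0 ->
    f1 - f2 - g = - g + (d2 - d1).
  move=> /eqP; rewrite addr_eq0 => /eqP -> /eqP; rewrite addr_eq0 => /eqP ->; ring.
(* For the second scallop the roles of the fields are exchanged, so the second-order lemmas concern
   the opposite of the bracket. The negated ansatz has the coefficients they require with [a] and
   [b] exchanged, since [vth] is antisymmetric. *)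
have jbx : jet (fun e => - quad 0 0 (- xi b a) e) 0 0 (xi b a).
  by apply: jqN; rewrite ?oppr0 ?opprK.
have jby : jet (fun e => - quad 0 0 0 e) 0 0 0 by apply: jqN; rewrite oppr0.
have jbt : jet (fun e => - quad 0 (vth a b) 0 e) 0 (vth b a) 0.
  by apply: jqN; rewrite ?oppr0.
have jbx' : jet (fun e => - quad 0 0 (xi a b) e) 0 0 (- xi a b).
  by apply: jqN; rewrite ?oppr0.
have jby' := jby; have jbt' := jbt.
have := @small_velocities a b
  (fun e => rx1 (B e) - quad 0 0 (xi a b) e) (fun e => ry1 (B e) - quad 0 0 0 e)
  (fun e => theta1 (B e) - quad 0 (vth a b) 0 e)
  (fun e => rx2 (B e) - quad 0 0 (- xi b a) e) (fun e => ry2 (B e) - quad 0 0 0 e)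
  (fun e => theta2 (B e) - quad 0 (vth a b) 0 e).
case.
- apply: (small_eqN (small_bracket_forceX jC1 jS1 jx jy jt jX jY jT
    (jq _ _ _) (jq _ _ _) (jq _ _ _) erefl erefl)) => e.
  have [[+ _ _] _] := bal01 e; have [[+ _ _] _] := bal10 e.
  rewrite oppr0 !mul0r !mul1r => h10 h01.
  by rewrite (forceX_sub 0) rx1B ry1B t1B (forceX_sub 0) (solve _ _ _ _ _ h01 h10).
- apply: (small_eqN (small_bracket_forceY jC1 jS1 jx jy jt jX jY jT
    (jq _ _ _) (jq _ _ _) (jq _ _ _) erefl erefl)) => e.
  have [[_ + _] _] := bal01 e; have [[_ + _] _] := bal10 e.
  rewrite oppr0 !mul0r !mul1r => h10 h01.
  by rewrite (forceY_sub 0) rx1B ry1B t1B (forceY_sub 0) (solve _ _ _ _ _ h01 h10).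
- apply: (small_eqN (small_bracket_torque jC1 jS1 jC2 jS2
    jx jy jt jx' jy' jt' jX jY jT jX' jY' jT'
    (jq _ _ _) (jq _ _ _) (jq _ _ _) (jq _ _ _) (jq _ _ _) (jq _ _ _)
    erefl erefl erefl erefl)) => e.
  have [[_ _ +] _] := bal01 e; have [[_ _ +] _] := bal10 e.
  rewrite oppr0 !mul0r !mul1r => h10 h01.
  by rewrite (torque_sub 0 0) rx1B ry1B t1B rx2B ry2B t2B
    (torque_sub 0 0) (solve _ _ _ _ _ h01 h10).
- apply: (small_eq (small_bracket_forceX jC2 jS2 jX' jY' jT' jx' jy' jt'
    jbx jby jbt erefl erefl)) => e.
  have [_ [+ _ _]] := bal01 e; have [_ [+ _ _]] := bal10 e.
  rewrite oppr0 !mul0r !mul1r => h10 h01.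
  by rewrite forceX_opp (forceX_sub 0) rx2B ry2B t2B (forceX_sub 0) (solve2 _ _ _ _ _ h01 h10).
- apply: (small_eq (small_bracket_forceY jC2 jS2 jX' jY' jT' jx' jy' jt'
    jbx jby jbt erefl erefl)) => e.
  have [_ [_ + _]] := bal01 e; have [_ [_ + _]] := bal10 e.
  rewrite oppr0 !mul0r !mul1r => h10 h01.
  by rewrite forceY_opp (forceY_sub 0) rx2B ry2B t2B (forceY_sub 0) (solve2 _ _ _ _ _ h01 h10).
- apply: (small_eq (small_bracket_torque jC2 jS2 jC1 jS1
    jX' jY' jT' jX jY jT jx' jy' jt' jx jy jt
    jbx jby jbt jbx' jby' jbt' erefl erefl erefl erefl)) => e.
  have [_ [_ _ +]] := bal01 e; have [_ [_ _ +]] := bal10 e.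
  rewrite oppr0 !mul0r !mul1r => h10 h01.
  by rewrite torque_opp (torque_sub 0 0) rx1B ry1B t1B rx2B ry2B t2B
    (torque_sub 0 0) (solve2 _ _ _ _ _ h01 h10).
by move=> [sx1 sy1 st1] [sx2 sy2 st2]; split; split; apply: jet_of_small (jq _ _ _) _.
Qed.

End BracketExpansion.

(** * Solutions of the control system and independence of the hinge positions *)

Lemma field_translation u1 u2 (x1 x2 : 'cV[R]_2) (z : 'cV[R]_8) :
  field u1 u2 (z + mkstate x1 0 x2 0 0 0) = field u1 u2 z.
Proof.
set h := mkstate _ _ _ _ _ _.
have h0 k : (k \in [:: 2; 5; 6; 7])%N -> h (inord k) 0 = 0.
  by rewrite !inE /h mxE => /or4P[] /eqP->; rewrite inordK.
have E1 : theta1 (z + h) = theta1 z by rewrite /theta1 mxE h0// addr0.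
have E2 : theta2 (z + h) = theta2 z by rewrite /theta2 mxE h0// addr0.
have E3 : sigma1 (z + h) = sigma1 z by rewrite /sigma1 mxE h0// addr0.
have E4 : sigma2 (z + h) = sigma2 z by rewrite /sigma2 mxE h0// addr0.
by rewrite /field E1 E2 E3 E4.
Qed.

(** The loop produces the bracket at the actual hinge positions, whereas [v3] evaluates it with both
    hinges at the origin. *)
Lemma lie_bracket_field_position (x1 x2 : 'cV[R]_2) (th0 phi eps : R) :
  lie_bracket (field 1 0) (field 0 1) (z0 x1 x2 th0 phi eps) =
  lie_bracket (field 1 0) (field 0 1) (z0 0 0 th0 phi eps).
Proof.
have -> : z0 x1 x2 th0 phi eps = z0 0 0 th0 phi eps + mkstate x1 0 x2 0 0 0.
  apply/matrixP => i j; rewrite !mxE.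
  by case: i => [[|[|[|[|[|[|[|[|]]]]]]]]] //= _; rewrite ?add0r ?addr0.
rewrite /lie_bracket !field_translation.
apply: (congr2 (fun U V : 'cV[R]_8 => U - V)); apply: diff_translation_invariant.
- by move=> y; exact: differentiable_field.
- by move=> y; exact: field_translation.
- by move=> y; exact: differentiable_field.
- by move=> y; exact: field_translation.
Qed.

(** The last two components of the field are the constant controls. *)
Lemma diff_field_controls u1 u2 (z h : 'cV[R]_8) :
  sigma1 ('d (field u1 u2) z h) = 0 /\ sigma2 ('d (field u1 u2) z h) = 0.
Proof.
have dF : differentiable (field u1 u2) z by exact: differentiable_field.
have zero i c : (forall y, field u1 u2 y i 0 = c) -> 'd (field u1 u2) z h i 0 = 0.
  move=> Fc; have := is_derive_along h i dF; under eq_fun do rewrite Fc.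
  by move=> D; rewrite -(@derive_val _ _ _ _ _ _ _ D) (derive_cst c).
by split; [apply: (zero _ u1) => y; exact: field_u1|apply: (zero _ u2) => y; exact: field_u2].
Qed.

Lemma solution_followed (g1 g2 tau : R) (zi : 'cV[R]_8) (z : R -> 'cV[R]_8) :
  0 < tau -> is_solution L Cpar Cperp lam g1 g2 zi tau z ->
  [/\ z 0 = zi,
      followed (field 0 1) (- g2) 0 tau z,
      followed (field 1 0) (- g1) tau (2 * tau) z,
      followed (field 0 1) g2 (2 * tau) (3 * tau) z &
      followed (field 1 0) g1 (3 * tau) (4 * tau) z].
Proof.
move=> tau0 [zc zi0 zd].
have sub a b : 0 <= a -> b <= 4 * tau -> {within `[a, b], continuous z}.
  move=> a0 b4; apply: continuous_subspaceW zc => t /=; rewrite !in_itv/=.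
  by move=> /andP[at_ tb]; rewrite (le_trans a0 at_) (le_trans tb b4).
rewrite v1_field v2_field in zd.
split=> //; (split; [apply: sub; lra|move=> t /andP[at_ tb]]).
- have := zd t; rewrite /u1 /u2 tb scale0r add0r; apply; lra.
- have h1 : (t < tau) = false by apply/negbTE; rewrite -leNgt; lra.
  by have := zd t; rewrite /u1 /u2 tb h1 scale0r addr0; apply; lra.
- have h1 : (t < tau) = false by apply/negbTE; rewrite -leNgt; lra.
  have h2 : (t < 2 * tau) = false by apply/negbTE; rewrite -leNgt; lra.
  by have := zd t; rewrite /u1 /u2 tb h1 h2 scale0r add0r; apply; lra.
- have h1 : (t < tau) = false by apply/negbTE; rewrite -leNgt; lra.
  have h2 : (t < 2 * tau) = false by apply/negbTE; rewrite -leNgt; lra.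
  have h3 : (t < 3 * tau) = false by apply/negbTE; rewrite -leNgt; lra.
  by have := zd t; rewrite /u1 /u2 h1 h2 h3 scale0r addr0; apply; lra.
Qed.

Lemma loop_expansion (g1 g2 th0 phi eps : R) (x1 x2 : 'cV[R]_2)
    (z : R -> R -> 'cV[R]_8) :
  (\forall tau \near 0^'+,
     is_solution L Cpar Cperp lam g1 g2 (z0 x1 x2 th0 phi eps) tau (z tau)) ->
  (fun tau : R => z tau (4 * tau)) =
  (fun tau : R => z0 x1 x2 th0 phi eps
     - (g1 * g2 * tau ^+ 2) *: v3 L Cpar Cperp lam th0 phi eps)
  +o_ (0^'+) (fun tau : R => tau ^+ 2).
Proof.
move=> hz; apply/eqaddoP => e e0.
have := @osmall_loop R 8 (field 1 0) (field 0 1) (z0 x1 x2 th0 phi eps) g1 g2 z.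
move=> /(_ (differentiable_field 1 0 _) (differentiable_field 0 1 _)) h.
have {}h := h _ e e0.
rewrite /v3 v1_field v2_field -(lie_bracket_field_position x1 x2).
near=> tau.
rewrite ger0_norm ?sqr_ge0//.
rewrite -[X in `|X|]/(z tau (4 * tau) - (z0 x1 x2 th0 phi eps
     - (g1 * g2 * tau ^+ 2) *: lie_bracket (field 1 0) (field 0 1) (z0 x1 x2 th0 phi eps))).
near: tau; apply: h; near=> tau; apply: solution_followed => //; near: tau.
exact: hz.
Unshelve. all: by end_near.
Qed.

(** * Expansion of [v3] and return to the original frame *)

Section Asymptotics.
Variables (th0 phi : R).

Local Notation B := (v3 L Cpar Cperp lam th0 phi).
Local Notation rx1 := (rx1 th0).
Local Notation ry1 := (ry1 th0).
Local Notation rx2 := (rx2 th0).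
Local Notation ry2 := (ry2 th0).

Lemma jet_v3 :
  [/\ jet (fun e => rx1 (B e)) 0 0 (xi 1 (cos phi)),
      jet (fun e => ry1 (B e)) 0 0 0 &
      jet (fun e => theta1 (B e)) 0 (vartheta lam phi) 0] /\
  [/\ jet (fun e => rx2 (B e)) 0 0 (- xi (cos phi) 1),
      jet (fun e => ry2 (B e)) 0 0 0 &
      jet (fun e => theta2 (B e)) 0 (vartheta lam phi) 0].
Proof.
have -> : B = fun e => lie_bracket (field 1 0) (field 0 1)
    (near_straight th0 1 (cos phi) e).
  apply/funext => e; rewrite /v3 v1_field v2_field; congr lie_bracket.
  by rewrite /near_straight /z0 mul1r [_ * e]mulrC; apply/matrixP => i j; rewrite !mxE.
have -> : vartheta lam phi = vth 1 (cos phi).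
  rewrite /vartheta /vth one_sub_cos; field.
  by case/andP: hlam => _ l1; rewrite lt0r_neq0// subr_gt0.
exact: jet_bracket.
Qed.

(* [x], [y] are the coordinates in the frame rotated by [th0]. *)
Lemma vec2_littleo (f : R -> 'cV[R]_2) (x y : R -> R) (k : R) :
  (forall e, x e = cos th0 * f e 0 0 + sin th0 * f e 1 0) ->
  (forall e, y e = cos th0 * f e 1 0 - sin th0 * f e 0 0) ->
  jet x 0 0 k -> jet y 0 0 0 ->
  f = (fun e => e ^+ 2 *: (k *: vec2 (cos th0) (sin th0)))
    +o_ (0^'+) (fun e : R => e ^+ 2).
Proof.
move=> xE yE jx jy; apply/eqaddoP => eta eta0.
have jN : jet (fun e => - (0 + 0 * e + k * e ^+ 2)) (- 0) (- 0) (- k).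
  exact: jetN (jet_poly 0 0 k).
have sx : small (fun e => x e - (0 + 0 * e + k * e ^+ 2)).
  by apply: jet_eq (jetD jx jN); rewrite ?oppr0 ?addr0 ?subrr.
(* Rotating back by [th0] recovers the two coordinates of the error of [f]. *)
have s0 : small (fun e => cos th0 * (x e - (0 + 0 * e + k * e ^+ 2)) + (- sin th0) * y e).
  by apply: smallD; exact: smallZ.
have s1 : small (fun e => sin th0 * (x e - (0 + 0 * e + k * e ^+ 2)) + cos th0 * y e).
  by apply: smallD; exact: smallZ.
have pq : cos th0 ^+ 2 + sin th0 ^+ 2 = 1 by exact: cos2Dsin2.
near=> e; apply: le_cV_norm; first by rewrite mulr_ge0// ltW.
have h0 : `|cos th0 * (x e - (0 + 0 * e + k * e ^+ 2)) + (- sin th0) * y e|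
    <= eta * `|e ^+ 2| by near: e; exact: small_littleo.
have h1 : `|sin th0 * (x e - (0 + 0 * e + k * e ^+ 2)) + cos th0 * y e|
    <= eta * `|e ^+ 2| by near: e; exact: small_littleo.
move=> i; rewrite -[X in `|X|]/((f e - e ^+ 2 *: (k *: vec2 (cos th0) (sin th0))) i 0).
have [->|->] : i = 0 \/ i = 1.
- by case: i => [[|[|]]] //= ?; [left|right]; apply/val_inj.
- apply: le_trans h0; rewrite !mxE /= xE yE le_eqVlt; apply/orP; left; apply/eqP.
  congr `|_|; rewrite -[f e 0 0 in LHS]mul1r -pq; ring.
- apply: le_trans h1; rewrite !mxE /= xE yE le_eqVlt; apply/orP; left; apply/eqP.
  congr `|_|; rewrite -[f e 1 0 in LHS]mul1r -pq; ring.
Unshelve. all: by end_near.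
Qed.

Lemma v3_controls (e : R) : sigma1 (B e) = 0 /\ sigma2 (B e) = 0.
Proof.
have sub (U V : 'cV[R]_8) : sigma1 U = 0 /\ sigma2 U = 0 ->
    sigma1 V = 0 /\ sigma2 V = 0 -> sigma1 (U - V) = 0 /\ sigma2 (U - V) = 0.
  by rewrite /sigma1 /sigma2 !mxE => -[-> ->] [-> ->]; rewrite subrr.
rewrite /v3 v1_field v2_field; apply: sub; exact: diff_field_controls.
Qed.

End Asymptotics.

End Scallops.

Theorem mainTheorem2 (R : realType) (L Cpar Cperp gamma1 gamma2 th0 phi lam : R)
    (x1 x2 : 'cV[R]_2)
    (hL : 0 < L) (hCpar : 0 < Cpar) (hCperp : 0 < Cperp)
    (hgamma1 : 0 < gamma1) (hgamma2 : 0 < gamma2)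
    (hth0 : 0 <= th0 < 2 * pi)
    (hlam : 0 < lam < 1)
    (hinv : forall th1 th2 sg1 sg2 : R,
        resistance L Cpar Cperp lam th1 th2 sg1 sg2 \in unitmx) :
  (\forall eps \near 0^'+,
     forall z : R -> R -> 'cV[R]_8,
       (\forall tau \near 0^'+,
          is_solution L Cpar Cperp lam gamma1 gamma2
            (z0 x1 x2 th0 phi eps) tau (z tau)) ->
       (fun tau : R => z tau (4 * tau)) =
       (fun tau : R => z0 x1 x2 th0 phi eps
          - (gamma1 * gamma2 * tau ^+ 2) *: v3 L Cpar Cperp lam th0 phi eps)
       +o_ (0^'+) (fun tau : R => tau ^+ 2))
  /\
  [/\ (fun eps : R => pos1 (v3 L Cpar Cperp lam th0 phi eps)) =
      (fun eps : R => eps ^+ 2 *: xieta1 L Cpar Cperp lam th0 phi)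
      +o_ (0^'+) (fun eps : R => eps ^+ 2),
      (fun eps : R => theta1 (v3 L Cpar Cperp lam th0 phi eps)) =
      (fun eps : R => vartheta lam phi * eps)
      +o_ (0^'+) (fun eps : R => eps ^+ 2),
      (fun eps : R => pos2 (v3 L Cpar Cperp lam th0 phi eps)) =
      (fun eps : R => eps ^+ 2 *: xieta2 L Cpar Cperp lam th0 phi)
      +o_ (0^'+) (fun eps : R => eps ^+ 2),
      (fun eps : R => theta2 (v3 L Cpar Cperp lam th0 phi eps)) =
      (fun eps : R => vartheta lam phi * eps)
      +o_ (0^'+) (fun eps : R => eps ^+ 2) &
      forall eps : R, 0 < eps ->
        sigma1 (v3 L Cpar Cperp lam th0 phi eps) = 0 /\
        sigma2 (v3 L Cpar Cperp lam th0 phi eps) = 0].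
Proof.
split.
  (* The loop expansion holds for every [eps]. *)
  by near=> eps => z; exact: loop_expansion.
have [[jx1 jy1 jt1] [jx2 jy2 jt2]] := jet_v3 hL hCpar hCperp hlam hinv th0 phi.
have neq0 : [/\ Cpar != 0, Cperp != 0 & 1 - lam ^+ 2 != 0].
  by split; [exact: lt0r_neq0|exact: lt0r_neq0|exact: lam2_neq0].
have [D0 C0 l2] := neq0.
(* With [a = 1] and [b = cos phi], the factor [a - b] of [xi] becomes [2 * sin (phi / 2) ^+ 2]. *)
have half := one_sub_cos phi.
split.
- have xiE : xi L Cpar Cperp lam 1 (cos phi) =
    L * lam * sin (phi / 2) ^+ 2 / (64 * Cpar * Cperp * (1 - lam ^+ 2))
    * ((Cperp ^+ 2 * (2 + lam) - Cpar * Cperp)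
      + cos phi * (3 * Cpar ^+ 2 - 2 * Cperp * Cpar - Cperp ^+ 2)).
    by rewrite /xi half; field; rewrite D0 C0 l2.
  rewrite /xieta1 -xiE.
  by apply: vec2_littleo jx1 jy1 => e; rewrite /rx1 /ry1 !mxE.
- by apply: scalar_littleo jt1 _ => e; ring.
- have xiE : - xi L Cpar Cperp lam (cos phi) 1 =
    L * lam * sin (phi / 2) ^+ 2 / (64 * Cpar * Cperp * (1 - lam ^+ 2))
    * ((3 * Cpar ^+ 2 - 2 * Cpar * Cperp - Cperp ^+ 2)
      + cos phi * (Cperp ^+ 2 * (2 + lam) - Cperp * Cpar)).
    by rewrite /xi -[cos phi - 1]opprB half; field; rewrite D0 C0 l2.
  rewrite /xieta2 -xiE.
  by apply: vec2_littleo jx2 jy2 => e; rewrite /rx2 /ry2 !mxE.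
- by apply: scalar_littleo jt2 _ => e; ring.
- by move=> eps _; exact: v3_controls.
Unshelve. all: by end_near.
Qed.
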